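(* Let $\mathscr C$ be a category and $F:\mathscr C^{\mathrm{op}}\to\mathbf{Cat}$ a tangent indexing functor. The tangent category $\mathbf{PC}(F)$, equipped with the tangent structure $(\underline T,\underline p,\underline 0,\underline +,\underline\ell,\underline c)$, is the pseudolimit of shape $F$ in $\mathfrak{Tan}$ and in $\mathfrak{Tan}_{\mathrm{strong}}$.
   Context: Tangent categories. A tangent structure $\mathbb T=(T,p,0,+,\ell,c)$ on a category $\mathscr D$ consists of a functor $T:\mathscr D\to\mathscr D$ and natural transformations $p:T\Rightarrow\mathrm{id}$, $0:\mathrm{id}\Rightarrow T$, $+:T_2\Rightarrow T$, $\ell:T\Rightarrow T^2$, $c:T^2\Rightarrow T^2$ such that: (1) for every object $A$ and $n\in\mathbb N$ the $n$-fold pullback power $T_nA$ of $p_A:TA\to A$ exists and is preserved by all $T^m$; (2) $(p_A,+_A,0_A)$ is a commutative monoid in $\mathscr D_{/A}$; (3) $T(p_A)\ell_A=0_Ap_A$, $\ell_A\circ{+_A}=T(+_A)\circ\langle\ell_A\pi_1,\ell_A\pi_2\rangle$, $\ell_A0_A=T(0_A)0_A$; (4) $p_{TA}c_A=T(p_A)$, $c_A\circ T(+_A)={+_{TA}}\circ\langle c_AT(\pi_1),c_AT(\pi_2)\rangle$, $c_AT(0_A)=0_{TA}$; (5) $c_Ac_A=\mathrm{id}$, $c_A\ell_A=\ell_A$, $T(\ell_A)\ell_A=\ell_{TA}\ell_A$, $c_{TA}T(c_A)c_{TA}=T(c_A)c_{TA}T(c_A)$, $c_{TA}T(c_A)\ell_{TA}=T(\ell_A)c_A$;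 (6) $T(+_A)\circ\langle\ell_A\pi_1,0_{TA}\pi_2\rangle:T_2A\to T^2A$ is an equalizer of $T(p_A)$ and $0_A\,p_A\,p_{TA}:T^2A\rightrightarrows TA$. $\mathfrak{Tan}$ is the $2$-category of tangent categories; a $1$-cell $(\mathscr D,\mathbb T)\to(\mathscr E,\mathbb S)$, $\mathbb S=(S,q,0',\oplus,\ell',c')$, is a pair $(H,\alpha)$, $H$ a functor and $\alpha:HT\Rightarrow SH$ natural with $(q H)\alpha=Hp$, $\alpha (H0)=0'H$, $\alpha (H{+})=(\oplus H)\alpha_2$, $(\ell' H)\alpha=(S\alpha)(\alpha T)(H\ell)$, $(c'H)(S\alpha)(\alpha T)=(S\alpha)(\alpha T)(Hc)$; composition is $(G,\beta)(H,\alpha)=(GH,(\beta H)(G\alpha))$. A $2$-cell $(H,\alpha)\Rightarrow(K,\beta)$ is a natural transformation $\rho:H\Rightarrow K$ with $(S\rho)\alpha=\beta(\rho T)$. $(H,\alpha)$ is strong if $\alpha$ is invertible and $H$ preserves the pullbacks and equalizers of the tangent structure; $\mathfrak{Tan}_{\mathrm{strong}}$ is the locally full sub-$2$-category on strong morphisms. Tangent indexing functors. Pseudofunctors are normalized, with compositors $\phi_{f,g}:F(f)F(g)\Rightarrow F(gf)$. A pseudofunctor $F:\mathscr C^{\mathrm{op}}\to\mathbf{Cat}$ is a tangent indexing functor if (i) each $F(X)$ has a tangent structure ${}_X\mathbb T=({}_XT,{}_Xp,{}_X0,{}_X{+},{}_X\ell,{}_Xc)$; (ii) for each $f:X\to Y$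 there is a natural isomorphism ${}_fT:F(f)\circ{}_YT\Rightarrow{}_XT\circ F(f)$ making $(F(f),{}_fT)$ a strong tangent morphism; (iii) the ${}_XT$ and ${}_fT^{-1}$ form a pseudonatural transformation $T:F\Rightarrow F$. Such an $F$ is also regarded as the pseudofunctor $\mathscr C^{\mathrm{op}}\to\mathfrak{Tan}_{\mathrm{strong}}\subseteq\mathfrak{Tan}$, $X\mapsto(F(X),{}_X\mathbb T)$, $f\mapsto(F(f),{}_fT)$, with the same compositors. $\mathbf{PC}(F)$: objects are families ${}_XA\in F(X)$ with isomorphisms $\tau^A_f:F(f)({}_YA)\to{}_XA$ ($f:X\to Y$) satisfying $\tau^A_{gf}\phi_{f,g}=\tau^A_f\circ F(f)(\tau^A_g)$; morphisms are families ${}_X\rho:{}_XA\to{}_XB$ with $\tau^B_f\circ F(f)({}_Y\rho)={}_X\rho\circ\tau^A_f$. Its tangent structure: $\underline TA$ has components ${}_XT({}_XA)$ and transition isomorphisms ${}_XT(\tau^A_f)\circ({}_fT)_{{}_YA}$; $\underline p,\underline 0,\underline +,\underline\ell,\underline c$ have $X$-components those of ${}_X\mathbb T$ at ${}_XA$. The limit pseudocone has $1$-cells the projections $\mathrm{pr}_X:A\mapsto{}_XA$ (strict tangent morphisms) and invertible $2$-cells $F(f)\circ\mathrm{pr}_Y\Rightarrow\mathrm{pr}_X$ with components $\tau^A_f$. Pseudolimits. For a pseudofunctor $D:\mathscr C^{\mathrm{op}}\to\mathcal K$ into a $2$-category, a pseudocone $(K,\kappa)$ consists of $1$-cells $\kappa_X:K\to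 D(X)$ and invertible $2$-cells $\kappa_f:D(f)\kappa_Y\Rightarrow\kappa_X$ ($f:X\to Y$) compatible with composition and identities. $(L,\lambda)$ is limiting (a pseudolimit) if for every pseudocone $(K,\kappa)$ there is a unique $r:K\to L$ with $\lambda_Xr=\kappa_X$ and $\lambda_f\ast r=\kappa_f$ for all $X,f$; and for every family of $2$-cells $\theta_X:\kappa_X\Rightarrow\kappa'_X$ between pseudocones with vertex $K$ compatible with the $\kappa_f,\kappa'_f$ there is a unique $2$-cell $\rho:r\Rightarrow r'$ with $\lambda_X\ast\rho=\theta_X$ for all $X$. *)

(* Defs.v *)
From mathcomp Require Import all_boot.
From Stdlib Require Import FunctionalExtensionality ProofIrrelevance IndefiniteDescription.

Set Implicit Arguments.
Unset Strict Implicit.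
Unset Printing Implicit Defensive.

Declare Scope cat_scope.
Delimit Scope cat_scope with cat.
Local Open Scope cat_scope.

Record Category : Type := MkCategory {
  Ob :> Type;
  Hom : Ob -> Ob -> Type;
  idm : forall A, Hom A A;
  compm : forall A B C, Hom B C -> Hom A B -> Hom A C;
  compmA : forall A B C D (h : Hom C D) (g : Hom B C) (f : Hom A B),
    compm h (compm g f) = compm (compm h g) f;
  comp1m : forall A B (f : Hom A B), compm (idm B) f = f;
  compm1 : forall A B (f : Hom A B), compm f (idm A) = f
}.
Arguments Hom {c} A B.
Arguments idm {c} A.
Arguments compm {c A B C} g f : rename.

Notation "A ~> B" := (Hom A B)
  (at level 99, B at level 200, right associativity) : cat_scope.
Notation "g ∘ f" := (compm g f) (at level 40, left associativity) : cat_scope.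

Record Functor (C D : Category) : Type := MkFunctor {
  fob :> C -> D;
  fmap : forall A B : C, (A ~> B) -> (fob A ~> fob B);
  fmap1 : forall A, fmap (idm A) = idm (fob A);
  fmapM : forall A B E (g : B ~> E) (f : A ~> B),
    fmap (g ∘ f) = fmap g ∘ fmap f
}.
Arguments fmap {C D} f {A B} _ : rename.

Definition idF (C : Category) : Functor C C :=
  @MkFunctor C C (fun A => A) (fun A B f => f)
    (fun A => erefl) (fun A B E g f => erefl).

Definition compF (C D E : Category) (G : Functor D E) (F : Functor C D) :
  Functor C E.
Proof.
refine (@MkFunctor C E (fun A => G (F A)) (fun A B f => fmap G (fmap F f)) _ _).
- abstract (by move=> A; rewrite !fmap1).
- abstract (by move=> A B B' g f; rewrite !fmapM).
Defined.

Record NatTrans (C D : Category) (F G : Functor C D) : Type := MkNatTrans {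
  ncomp :> forall A : C, F A ~> G A;
  naturality : forall (A B : C) (f : A ~> B),
    ncomp B ∘ fmap F f = fmap G f ∘ ncomp A
}.

Definition is_inverse (C : Category) (A B : C) (f : A ~> B) (g : B ~> A) :
  Prop := g ∘ f = idm A /\ f ∘ g = idm B.

Definition is_iso (C : Category) (A B : C) (f : A ~> B) : Prop :=
  exists g, is_inverse f g.

Lemma nat_ext (C D : Category) (F G : Functor C D) (a b : NatTrans F G) :
  (forall A, a A = b A) -> a = b.
Proof.
case: a b => [a na] [b nb] /= e.
have e' : a = b by apply: functional_extensionality_dep.
by subst b; f_equal; apply: proof_irrelevance.
Qed.

Definition idN (C D : Category) (F : Functor C D) : NatTrans F F.
Proof.
refine (@MkNatTrans C D F F (fun A => idm (F A)) _).
abstract (by move=> A B f; rewrite comp1m compm1).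
Defined.

Definition compN (C D : Category) (F G H : Functor C D)
  (b : NatTrans G H) (a : NatTrans F G) : NatTrans F H.
Proof.
refine (@MkNatTrans C D F H (fun A => b A ∘ a A) _).
abstract (by move=> A B f; rewrite -compmA naturality compmA naturality compmA).
Defined.

Definition lwhiskN (C D E : Category) (H : Functor D E) (F G : Functor C D)
  (a : NatTrans F G) : NatTrans (compF H F) (compF H G).
Proof.
refine (@MkNatTrans C E (compF H F) (compF H G) (fun A => fmap H (a A)) _).
abstract (by move=> A B f; rewrite /= -!fmapM naturality).
Defined.

Definition rwhiskN (C D E : Category) (F G : Functor D E)
  (a : NatTrans F G) (H : Functor C D) : NatTrans (compF F H) (compF G H).
Proof.
refine (@MkNatTrans C E (compF F H) (compF G H) (fun A => a (H A)) _).
abstract (by move=> A B f; rewrite /= naturality).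
Defined.

Record TwoCategoryData : Type := MkTwoCategoryData {
  ob0 :> Type;
  hom1 : ob0 -> ob0 -> Type;
  hom2 : forall A B, hom1 A B -> hom1 A B -> Type;
  id1 : forall A, hom1 A A;
  comp1 : forall A B C, hom1 B C -> hom1 A B -> hom1 A C;
  id2 : forall A B (f : hom1 A B), hom2 f f;
  vcomp : forall A B (f g h : hom1 A B), hom2 g h -> hom2 f g -> hom2 f h;
  lwhisk : forall A B C (h : hom1 B C) (f g : hom1 A B),
    hom2 f g -> hom2 (comp1 h f) (comp1 h g);
  rwhisk : forall A B C (f g : hom1 B C), hom2 f g ->
    forall h : hom1 A B, hom2 (comp1 f h) (comp1 g h)
}.
Arguments hom1 {t} A B.
Arguments hom2 {t A B} f g.
Arguments id1 {t} A.
Arguments comp1 {t A B C} g f : rename.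
Arguments id2 {t A B} f.
Arguments vcomp {t A B f g h} b a : rename.
Arguments lwhisk {t A B C} h {f g} a : rename.
Arguments rwhisk {t A B C f g} a h : rename.

Notation "g ⋅ f" := (comp1 g f) (at level 40, left associativity) : cat_scope.
Notation "b • a" := (vcomp b a) (at level 45, left associativity) : cat_scope.
Notation "h ◁ a" := (lwhisk h a) (at level 42, right associativity) : cat_scope.
Notation "a ▷ h" := (rwhisk a h) (at level 42, right associativity) : cat_scope.

(* The identity 2-cell between two 1-cells that are provably equal.  It is used
   only to make strict equalities of 1-cells (associativity, units,
   normalization, uniqueness in the universal property) typecheck on 2-cells. *)
Definition coe (K : TwoCategoryData) (A B : K) (f g : hom1 A B) (e : f = g) :
  hom2 f g := match e in _ = g' return hom2 f g' with erefl => id2 f end.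

Record TwoCategory : Type := MkTwoCategory {
  tcd :> TwoCategoryData;
  comp1A : forall (A B C D : tcd) (h : hom1 C D) (g : hom1 B C) (f : hom1 A B),
    h ⋅ (g ⋅ f) = h ⋅ g ⋅ f;
  comp1_1l : forall (A B : tcd) (f : hom1 A B), id1 B ⋅ f = f;
  comp1_1r : forall (A B : tcd) (f : hom1 A B), f ⋅ id1 A = f;
  vcompA : forall (A B : tcd) (f g h k : hom1 A B)
    (c : hom2 h k) (b : hom2 g h) (a : hom2 f g), c • (b • a) = c • b • a;
  vcomp_1l : forall (A B : tcd) (f g : hom1 A B) (a : hom2 f g), id2 g • a = a;
  vcomp_1r : forall (A B : tcd) (f g : hom1 A B) (a : hom2 f g), a • id2 f = a;
  lwhisk1 : forall (A B C : tcd) (h : hom1 B C) (f : hom1 A B),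
    h ◁ id2 f = id2 (h ⋅ f);
  lwhiskM : forall (A B C : tcd) (h : hom1 B C) (f g k : hom1 A B)
    (b : hom2 g k) (a : hom2 f g), h ◁ (b • a) = (h ◁ b) • (h ◁ a);
  rwhisk1 : forall (A B C : tcd) (f : hom1 B C) (h : hom1 A B),
    id2 f ▷ h = id2 (f ⋅ h);
  rwhiskM : forall (A B C : tcd) (f g k : hom1 B C)
    (b : hom2 g k) (a : hom2 f g) (h : hom1 A B),
    (b • a) ▷ h = (b ▷ h) • (a ▷ h);
  interchange : forall (A B C : tcd) (h k : hom1 B C) (b : hom2 h k)
    (f g : hom1 A B) (a : hom2 f g), (k ◁ a) • (b ▷ f) = (b ▷ g) • (h ◁ a);
  lwhisk_1 : forall (A B : tcd) (f g : hom1 A B) (a : hom2 f g),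
    coe (comp1_1l g) • (id1 B ◁ a) = a • coe (comp1_1l f);
  rwhisk_1 : forall (A B : tcd) (f g : hom1 A B) (a : hom2 f g),
    coe (comp1_1r g) • (a ▷ id1 A) = a • coe (comp1_1r f);
  lwhisk_comp : forall (A B C D : tcd) (k : hom1 C D) (h : hom1 B C)
    (f g : hom1 A B) (a : hom2 f g),
    coe (comp1A k h g) • (k ◁ (h ◁ a)) = ((k ⋅ h) ◁ a) • coe (comp1A k h f);
  rwhisk_comp : forall (A B C D : tcd) (f g : hom1 C D) (a : hom2 f g)
    (h : hom1 B C) (k : hom1 A B),
    coe (comp1A g h k) • (a ▷ (h ⋅ k)) = ((a ▷ h) ▷ k) • coe (comp1A f h k);
  lrwhisk : forall (A B C D : tcd) (h : hom1 C D) (f g : hom1 B C)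
    (a : hom2 f g) (k : hom1 A B),
    coe (comp1A h g k) • (h ◁ (a ▷ k)) = ((h ◁ a) ▷ k) • coe (comp1A h f k)
}.

Definition invertible2 (K : TwoCategory) (A B : K) (f g : hom1 A B)
  (a : hom2 f g) : Prop :=
  exists b : hom2 g f, b • a = id2 f /\ a • b = id2 g.

Definition CatData : TwoCategoryData :=
  @MkTwoCategoryData Category Functor NatTrans idF compF idN compN
    lwhiskN rwhiskN.

Definition eqhom (C : Category) (A B : C) (e : A = B) : A ~> B :=
  match e in _ = B' return A ~> B' with erefl => idm A end.

Lemma eqhom_id (C : Category) (A : C) (e : A = A) : eqhom e = idm A.
Proof. by rewrite (proof_irrelevance _ e erefl). Qed.

Lemma coe_Cat (C D : CatData) (F G : hom1 C D) (e : F = G) (A : Ob C) :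
  (coe e : NatTrans F G) A = eqhom (f_equal (fun H : Functor C D => H A) e).
Proof. by case: G / e. Qed.

Lemma functor_eq (C D : Category) (F G : Functor C D)
  (e : forall A, F A = G A) :
  (forall A B (f : A ~> B), eqhom (e B) ∘ fmap F f = fmap G f ∘ eqhom (e A)) ->
  F = G.
Proof.
case: F G e => [F0 F1 p q] [G0 G1 p' q'] /= e.
have e0 : F0 = G0 by apply: functional_extensionality.
subst G0 => h.
have e1 : F1 = G1.
  apply: functional_extensionality_dep => A.
  apply: functional_extensionality_dep => B.
  apply: functional_extensionality_dep => f.
  by have := h _ _ f; rewrite !eqhom_id comp1m compm1.
by subst G1; f_equal; apply: proof_irrelevance.
Qed.

Ltac functor_refl :=
  unshelve eapply functor_eq;
  [ by move=> ? | by move=> ? ? ?; rewrite !eqhom_id comp1m compm1 ].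

Lemma compFA (A B C D : Category) (H : Functor C D) (G : Functor B C)
  (F : Functor A B) : compF H (compF G F) = compF (compF H G) F.
Proof. by functor_refl. Qed.

Lemma compF1l (A B : Category) (F : Functor A B) : compF (idF B) F = F.
Proof. by functor_refl. Qed.

Lemma compF1r (A B : Category) (F : Functor A B) : compF F (idF A) = F.
Proof. by functor_refl. Qed.

Definition Cat : TwoCategory.
Proof.
refine (@MkTwoCategory CatData compFA compF1l compF1r _ _ _ _ _ _ _ _ _ _ _ _ _);
  abstract (by intros; apply: nat_ext => X; rewrite /= ?coe_Cat ?eqhom_id /=
    ?compmA ?comp1m ?compm1 ?fmap1 ?fmapM ?naturality).
Defined.

Section Sub2.
Variables (K : TwoCategory) (P : forall A B : K, hom1 A B -> Prop).
Hypothesis P1 : forall A, P (id1 A).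
Hypothesis PM : forall (A B C : K) (g : hom1 B C) (f : hom1 A B),
  P g -> P f -> P (g ⋅ f).

Record subhom1 (A B : K) : Type := MkSubhom1 {
  sub1 :> hom1 A B; sub1P : P sub1 }.

Lemma subhom1_eq (A B : K) (f g : subhom1 A B) :
  sub1 f = sub1 g -> f = g.
Proof.
by case: f g => f pf [g pg] /= e; subst g; f_equal; apply: proof_irrelevance.
Qed.

Definition sub2_id A : subhom1 A A := MkSubhom1 (P1 A).
Definition sub2_comp (A B C : K) (g : subhom1 B C) (f : subhom1 A B) :
  subhom1 A C := MkSubhom1 (PM (sub1P g) (sub1P f)).

Definition Sub2Data : TwoCategoryData :=
  @MkTwoCategoryData K subhom1 (fun A B f g => hom2 (sub1 f) (sub1 g))
    sub2_id sub2_comp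
    (fun A B f => id2 (sub1 f)) (fun A B f g h b a => b • a)
    (fun A B C h f g a => sub1 h ◁ a) (fun A B C f g a h => a ▷ sub1 h).

Lemma coe_Sub2 (A B : Sub2Data) (f g : hom1 A B) (e : f = g) :
  coe e = @coe K A B (sub1 f) (sub1 g) (f_equal (@sub1 A B) e).
Proof. by case: g / e. Qed.

Definition Sub2 : TwoCategory.
Proof.
refine (@MkTwoCategory Sub2Data
  (fun A B C D h g f => subhom1_eq (f := sub2_comp h (sub2_comp g f))
     (g := sub2_comp (sub2_comp h g) f) (comp1A (sub1 h) (sub1 g) (sub1 f)))
  (fun A B f => subhom1_eq (f := sub2_comp (sub2_id B) f) (comp1_1l (sub1 f)))
  (fun A B f => subhom1_eq (f := sub2_comp f (sub2_id A)) (comp1_1r (sub1 f)))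
  _ _ _ _ _ _ _ _ _ _ _ _ _).
- abstract (intros; exact: vcompA).
- abstract (intros; exact: vcomp_1l).
- abstract (intros; exact: vcomp_1r).
- abstract (intros; exact: lwhisk1).
- abstract (intros; exact: lwhiskM).
- abstract (intros; exact: rwhisk1).
- abstract (intros; exact: rwhiskM).
- abstract (intros; exact: interchange).
- abstract (intros; rewrite !coe_Sub2 /=;
    move: (f_equal _ _) (f_equal _ _) => /= e1 e2;
    rewrite (proof_irrelevance _ e1 (comp1_1l _));
    rewrite (proof_irrelevance _ e2 (comp1_1l _)); exact: lwhisk_1).
- abstract (intros; rewrite !coe_Sub2 /=;
    move: (f_equal _ _) (f_equal _ _) => /= e1 e2;
    rewrite (proof_irrelevance _ e1 (comp1_1r _));
    rewrite (proof_irrelevance _ e2 (comp1_1r _)); exact: rwhisk_1).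
- abstract (intros; rewrite !coe_Sub2 /=;
    move: (f_equal _ _) (f_equal _ _) => /= e1 e2;
    rewrite (proof_irrelevance _ e1 (comp1A _ _ _));
    rewrite (proof_irrelevance _ e2 (comp1A _ _ _)); exact: lwhisk_comp).
- abstract (intros; rewrite !coe_Sub2 /=;
    move: (f_equal _ _) (f_equal _ _) => /= e1 e2;
    rewrite (proof_irrelevance _ e1 (comp1A _ _ _));
    rewrite (proof_irrelevance _ e2 (comp1A _ _ _)); exact: rwhisk_comp).
- abstract (intros; rewrite !coe_Sub2 /=;
    move: (f_equal _ _) (f_equal _ _) => /= e1 e2;
    rewrite (proof_irrelevance _ e1 (comp1A _ _ _));
    rewrite (proof_irrelevance _ e2 (comp1A _ _ _)); exact: lrwhisk).
Defined.

End Sub2.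
(* A normalized pseudofunctor from the opposite of [C]. *)
Record PseudoFunctor (C : Category) (K : TwoCategory) : Type := MkPseudoFunctor {
  pf0 :> C -> K;
  pf1 : forall X Y : C, (X ~> Y) -> hom1 (pf0 Y) (pf0 X);
  pf2 : forall (X Y Z : C) (f : X ~> Y) (g : Y ~> Z),
    hom2 (pf1 f ⋅ pf1 g) (pf1 (g ∘ f));
  pf_id : forall X : C, pf1 (idm X) = id1 (pf0 X);
  pf2_inv : forall (X Y Z : C) (f : X ~> Y) (g : Y ~> Z),
    invertible2 (pf2 f g);
  pf2_idl : forall (X Y : C) (f : X ~> Y),
    pf2 (idm X) f = coe (etrans (f_equal (fun u => u ⋅ pf1 f) (pf_id X))
                         (etrans (comp1_1l (pf1 f)) (f_equal (@pf1 X Y) (esym (compm1 f)))));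
  pf2_idr : forall (X Y : C) (f : X ~> Y),
    pf2 f (idm Y) = coe (etrans (f_equal (fun u => pf1 f ⋅ u) (pf_id Y))
                         (etrans (comp1_1r (pf1 f)) (f_equal (@pf1 X Y) (esym (comp1m f)))));
  pf2_assoc : forall (W X Y Z : C) (f : W ~> X) (g : X ~> Y) (h : Y ~> Z),
    coe (f_equal (@pf1 W Z) (compmA h g f)) •
      (pf2 (g ∘ f) h • (pf2 f g ▷ pf1 h) • coe (comp1A (pf1 f) (pf1 g) (pf1 h)))
    = pf2 f (h ∘ g) • (pf1 f ◁ pf2 g h) :> hom2 _ _
}.
Arguments pf1 {C K} p {X Y} f.
Arguments pf2 {C K} p {X Y Z} f g.
Arguments pf_id {C K} p X.

(* [t1], [t2] are the components of a pseudonatural transformation [D => E]. *)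
Record is_pseudonat (C : Category) (K : TwoCategory) (D E : PseudoFunctor C K)
  (t1 : forall X : C, hom1 (D X) (E X))
  (t2 : forall (X Y : C) (f : X ~> Y), hom2 (t1 X ⋅ pf1 D f) (pf1 E f ⋅ t1 Y)) :
  Prop := MkIsPseudonat {
  pn_inv : forall (X Y : C) (f : X ~> Y), invertible2 (t2 X Y f);
  pn_id : forall X : C,
    t2 X X (idm X)
    = coe (etrans (f_equal (fun u => t1 X ⋅ u) (pf_id D X))
          (etrans (etrans (comp1_1r (t1 X)) (esym (comp1_1l (t1 X))))
                  (f_equal (fun u => u ⋅ t1 X) (esym (pf_id E X)))));
  pn_comp : forall (X Y Z : C) (f : X ~> Y) (g : Y ~> Z),
    t2 X Z (g ∘ f) • (t1 X ◁ pf2 D f g)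
    = (pf2 E f g ▷ t1 Z) • coe (comp1A (pf1 E f) (pf1 E g) (t1 Z))
      • (pf1 E f ◁ t2 Y Z g) • coe (esym (comp1A (pf1 E f) (t1 Y) (pf1 D g)))
      • (t2 X Y f ▷ pf1 D g) • coe (comp1A (t1 X) (pf1 D f) (pf1 D g))
}.

Record PseudoCone (C : Category) (K : TwoCategory) (D : PseudoFunctor C K)
  (V : K) : Type := MkPseudoCone {
  pc1 : forall X : C, hom1 V (D X);
  pc2 : forall (X Y : C) (f : X ~> Y), hom2 (pf1 D f ⋅ pc1 Y) (pc1 X);
  pc2_inv : forall (X Y : C) (f : X ~> Y), invertible2 (pc2 f);
  pc2_id : forall X : C,
    pc2 (idm X) = coe (etrans (f_equal (fun u => u ⋅ pc1 X) (pf_id D X))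
                              (comp1_1l (pc1 X)));
  pc2_comp : forall (X Y Z : C) (f : X ~> Y) (g : Y ~> Z),
    pc2 (g ∘ f) • (pf2 D f g ▷ pc1 Z) • coe (comp1A (pf1 D f) (pf1 D g) (pc1 Z))
    = pc2 f • (pf1 D f ◁ pc2 g)
}.
Arguments pc1 {C K D V} p X.
Arguments pc2 {C K D V} p {X Y} f.

(* [factors l k r e]: the 1-cell [r] satisfies [l_X r = k_X] (by [e]) and
   [l_f * r = k_f]. *)
Definition factors (C : Category) (K : TwoCategory) (D : PseudoFunctor C K)
  (L : K) (l : PseudoCone D L) (V : K) (k : PseudoCone D V) (r : hom1 V L)
  (e : forall X : C, pc1 l X ⋅ r = pc1 k X) : Prop :=
  forall (X Y : C) (f : X ~> Y),
    coe (e X) • (pc2 l f ▷ r) • coe (comp1A (pf1 D f) (pc1 l Y) r)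
    = pc2 k f • (pf1 D f ◁ coe (e Y)).

Definition is_modification (C : Category) (K : TwoCategory)
  (D : PseudoFunctor C K) (V : K) (k k' : PseudoCone D V)
  (th : forall X : C, hom2 (pc1 k X) (pc1 k' X)) : Prop :=
  forall (X Y : C) (f : X ~> Y),
    th X • pc2 k f = pc2 k' f • (pf1 D f ◁ th Y).

Record is_pseudolimit (C : Category) (K : TwoCategory) (D : PseudoFunctor C K)
  (L : K) (l : PseudoCone D L) : Prop := MkIsPseudolimit {
  pl_1 : forall (V : K) (k : PseudoCone D V),
    exists! r : hom1 V L, exists e, factors (l := l) (k := k) (r := r) e;
  pl_2 : forall (V : K) (k k' : PseudoCone D V) (r r' : hom1 V L)
    (e : forall X : C, pc1 l X ⋅ r = pc1 k X)
    (e' : forall X : C, pc1 l X ⋅ r' = pc1 k' X),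
    factors e -> factors e' ->
    forall th : forall X : C, hom2 (pc1 k X) (pc1 k' X), is_modification th ->
    exists! rho : hom2 r r',
      forall X : C, coe (e' X) • (pc1 l X ◁ rho) = th X • coe (e X)
}.

Section Lift.
Variables (K : TwoCategory) (P : forall A B : K, hom1 A B -> Prop).
Hypothesis P1 : forall A, P (id1 A).
Hypothesis PM : forall (A B C : K) (g : hom1 B C) (f : hom1 A B),
  P g -> P f -> P (g ⋅ f).
Variables (C : Category) (D : PseudoFunctor C K).
Hypothesis PD : forall (X Y : C) (f : X ~> Y), P (pf1 D f).

Let S := Sub2 P1 PM.

Lemma coe_irr (A B : K) (f g : hom1 A B) (e e' : f = g) : coe e = coe e'.
Proof. by rewrite (proof_irrelevance _ e e'). Qed.

Definition lift_pf : PseudoFunctor C S.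
Proof.
refine (@MkPseudoFunctor C S (fun X => D X)
  (fun X Y f => MkSubhom1 (PD f)) (fun X Y Z f g => pf2 D f g)
  (fun X => subhom1_eq (f := MkSubhom1 (PD (idm X))) (g := sub2_id P1 (D X)) (pf_id D X))
  _ _ _ _).
- abstract (by move=> X Y Z f g; exact: pf2_inv).
- abstract (by move=> X Y f; rewrite coe_Sub2 /= pf2_idl; apply: coe_irr).
- abstract (by move=> X Y f; rewrite coe_Sub2 /= pf2_idr; apply: coe_irr).
- abstract (by move=> W X Y Z f g h; rewrite !coe_Sub2 /= -pf2_assoc /=;
    repeat (f_equal; try exact: coe_irr)).
Defined.

Variables (V : K) (k : PseudoCone D V).
Hypothesis Pk : forall X, P (pc1 k X).

Definition lift_cone : PseudoCone lift_pf (V : S).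
Proof.
refine (@MkPseudoCone C S lift_pf V (fun X => MkSubhom1 (Pk X))
  (fun X Y f => pc2 k f) _ _ _).
- abstract (by move=> X Y f; exact: pc2_inv).
- abstract (by move=> X; rewrite coe_Sub2 /= pc2_id; apply: coe_irr).
- abstract (by move=> X Y Z f g; rewrite coe_Sub2 /= -pc2_comp;
    f_equal; exact: coe_irr).
Defined.

End Lift.
(* [P], with structure map [b : P ~> B] and projections [pi i], is the [n]-fold
   pullback power of [f : E ~> B], i.e. the [n]-th power of [f] in the slice
   over [B]. *)
Record is_fibre_power (D : Category) (n : nat) (E B : D) (f : E ~> B)
  (P : D) (b : P ~> B) (pi : 'I_n -> (P ~> E)) : Prop := MkIsFibrePower {
  ifp_comm : forall i, f ∘ pi i = b;
  ifp_univ : forall (Z : D) (z : Z ~> B) (x : 'I_n -> (Z ~> E)),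
    (forall i, f ∘ x i = z) ->
    exists! h : Z ~> P, b ∘ h = z /\ forall i, pi i ∘ h = x i
}.

Record FibrePower (D : Category) (n : nat) (E B : D) (f : E ~> B) : Type :=
  MkFibrePower {
  fp_ob :> D;
  fp_base : fp_ob ~> B;
  fp_proj : 'I_n -> (fp_ob ~> E);
  fpP : is_fibre_power f fp_base fp_proj
}.
Arguments fp_ob {D n E B f} f0 : rename.
Arguments fp_base {D n E B f} f0 : rename.
Arguments fp_proj {D n E B f} f0 i : rename.
Arguments fpP {D n E B f} f0 : rename.

Definition preserves_fibre_power (D D' : Category) (H : Functor D D') (n : nat)
  (E B : D) (f : E ~> B) (P : FibrePower n f) : Prop :=
  is_fibre_power (fmap H f) (fmap H (fp_base P)) (fun i => fmap H (fp_proj P i)).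

(* [u = <x, y>], for [P] a binary fibre power with projections [pi]. *)
Definition is_pair (D : Category) (Z P E : D) (pi : 'I_2 -> (P ~> E))
  (u : Z ~> P) (x y : Z ~> E) : Prop :=
  pi ord0 ∘ u = x /\ pi ord_max ∘ u = y.

Definition is_equalizer (D : Category) (E A B : D) (e : E ~> A) (f g : A ~> B) :
  Prop :=
  f ∘ e = g ∘ e /\
  forall (Z : D) (z : Z ~> A), f ∘ z = g ∘ z -> exists! h : Z ~> E, e ∘ h = z.

Lemma rea (D : Category) (X Y Z : D) (g : Y ~> Z) (f : X ~> Y) (k : X ~> Z)
  (e : g ∘ f = k) (W : D) (x : Z ~> W) : x ∘ g ∘ f = x ∘ k.
Proof. by rewrite -compmA e. Qed.

Lemma rea3 (D : Category) (V X Y Z : D) (h : Y ~> Z) (g : X ~> Y) (f : V ~> X)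
  (k : V ~> Z) (e : h ∘ g ∘ f = k) (W : D) (x : Z ~> W) :
  x ∘ h ∘ g ∘ f = x ∘ k.
Proof. by rewrite -e !compmA. Qed.

Section FibrePowerTheory.
Variable D : Category.

Definition fp_tuple (n : nat) (E B : D) (f : E ~> B) (P : FibrePower n f)
  (Z : D) (z : Z ~> B) (x : 'I_n -> (Z ~> E)) (e : forall i, f ∘ x i = z) :
  Z ~> P :=
  proj1_sig (constructive_definite_description _ (ifp_univ (fpP P) e)).

Lemma fp_tuple_base (n : nat) (E B : D) (f : E ~> B) (P : FibrePower n f)
  (Z : D) (z : Z ~> B) (x : 'I_n -> (Z ~> E)) (e : forall i, f ∘ x i = z) :
  fp_base P ∘ fp_tuple P e = z.
Proof. by rewrite /fp_tuple; case: constructive_definite_description => h []. Qed.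

Lemma fp_tuple_proj (n : nat) (E B : D) (f : E ~> B) (P : FibrePower n f)
  (Z : D) (z : Z ~> B) (x : 'I_n -> (Z ~> E)) (e : forall i, f ∘ x i = z) i :
  fp_proj P i ∘ fp_tuple P e = x i.
Proof. by rewrite /fp_tuple; case: constructive_definite_description => h [_ /=]. Qed.

Lemma ifp_uniq (n : nat) (E B : D) (f : E ~> B) (P : D) (b : P ~> B)
  (pi : 'I_n -> (P ~> E)) (Z : D) (h h' : Z ~> P) :
  is_fibre_power f b pi ->
  b ∘ h = b ∘ h' -> (forall i, pi i ∘ h = pi i ∘ h') -> h = h'.
Proof.
move=> [c U] eb ep.
have [i|k [_ u]] := U Z (b ∘ h') (fun i => pi i ∘ h'); first by rewrite compmA c.
by rewrite -(u h) // -(u h').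
Qed.

Lemma ord2_ind (Q : 'I_2 -> Prop) : Q ord0 -> Q ord_max -> forall i, Q i.
Proof.
move=> q0 q1 [[|[|m]] lm] //.
- by rewrite (_ : Ordinal lm = ord0) //; apply: val_inj.
- by rewrite (_ : Ordinal lm = ord_max) //; apply: val_inj.
Qed.

Lemma ifp_uniq2 (E B : D) (f : E ~> B) (P : D) (b : P ~> B)
  (pi : 'I_2 -> (P ~> E)) (Z : D) (h h' : Z ~> P) :
  is_fibre_power f b pi ->
  pi ord0 ∘ h = pi ord0 ∘ h' -> pi ord_max ∘ h = pi ord_max ∘ h' -> h = h'.
Proof.
move=> fP e0 e1; apply: (ifp_uniq fP); last by apply: ord2_ind.
by rewrite -(ifp_comm fP ord0) -!compmA e0.
Qed.

Lemma ifp_pair (E B : D) (f : E ~> B) (P : D) (b : P ~> B)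
  (pi : 'I_2 -> (P ~> E)) (Z : D) (x y : Z ~> E) :
  is_fibre_power f b pi -> f ∘ x = f ∘ y -> exists u, is_pair pi u x y.
Proof.
move=> fP e.
have [|u [[_ h] _]] := @ifp_univ _ _ _ _ _ _ _ _ fP Z (f ∘ x)
  (fun i => if i == ord0 then x else y).
  by apply: ord2_ind => /=; rewrite ?e.
by exists u; split; rewrite h.
Qed.

Lemma iso_mono (X Y Z : D) (f : Y ~> Z) (g h : X ~> Y) :
  is_iso f -> f ∘ g = f ∘ h -> g = h.
Proof.
by case=> k [kf _] e; rewrite -(comp1m g) -(comp1m h) -kf -!compmA e.
Qed.

Lemma iso_epi (X Y Z : D) (f : X ~> Y) (g h : Y ~> Z) :
  is_iso f -> g ∘ f = h ∘ f -> g = h.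
Proof.
by case=> k [_ fk] e; rewrite -(compm1 g) -(compm1 h) -fk !compmA e.
Qed.

Lemma is_iso_comp (X Y Z : D) (g : Y ~> Z) (f : X ~> Y) :
  is_iso g -> is_iso f -> is_iso (g ∘ f).
Proof.
move=> [g' [g1 g2]] [f' [f1 f2]]; exists (f' ∘ g'); split.
- by rewrite !compmA (rea g1) compm1.
- by rewrite !compmA (rea f2) compm1.
Qed.

Lemma is_iso_id (X : D) : is_iso (idm X).
Proof. by exists (idm X); split; rewrite comp1m. Qed.

Lemma ifp_iso (n : nat) (E B P E' B' P' : D) (f : E ~> B) (b : P ~> B)
  (pi : 'I_n -> (P ~> E)) (f' : E' ~> B') (b' : P' ~> B')
  (pi' : 'I_n -> (P' ~> E')) (fi : E ~> E') (psi : B ~> B') (th : P ~> P') :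
  is_iso fi -> is_iso psi -> is_iso th ->
  f' ∘ fi = psi ∘ f -> b' ∘ th = psi ∘ b ->
  (forall i, pi' i ∘ th = fi ∘ pi i) ->
  is_fibre_power f b pi -> is_fibre_power f' b' pi'.
Proof.
move=> ifi ipsi ith ef eb epi fP.
have [fi' [fi1 fi2]] := ifi; have [ps' [ps1 ps2]] := ipsi.
have [th' [th1 th2]] := ith.
have epi2 i : pi' i = fi ∘ pi i ∘ th' by rewrite -epi -compmA th2 compm1.
have eb2 : b' = psi ∘ b ∘ th' by rewrite -eb -compmA th2 compm1.
split=> [i|Z z x ex].
  by apply: (iso_epi ith); rewrite -compmA epi compmA ef eb -compmA (ifp_comm fP).
have [i|h [[hb hp] hu]] := @ifp_univ _ _ _ _ _ _ _ _ fP Z (ps' ∘ z) (fun i => fi' ∘ x i).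
  apply: (iso_mono ipsi).
  by rewrite !compmA -ef (rea fi2) compm1 ps2 comp1m ex.
exists (th ∘ h); split; first split.
- by rewrite compmA eb -compmA hb compmA ps2 comp1m.
- by move=> i; rewrite compmA epi -compmA hp compmA fi2 comp1m.
move=> k [kb kp]; rewrite (hu (th' ∘ k)).
  by rewrite compmA th2 comp1m.
split.
- by rewrite -kb eb2 !compmA ps1 comp1m.
- by move=> i; rewrite -kp epi2 !compmA fi1 comp1m.
Qed.

Lemma ifp_comparison (n : nat) (E B P E' B' P' : D) (f : E ~> B) (b : P ~> B)
  (pi : 'I_n -> (P ~> E)) (f' : E' ~> B') (b' : P' ~> B')
  (pi' : 'I_n -> (P' ~> E')) (fi : E ~> E') (psi : B ~> B') (th : P ~> P') :
  is_iso fi -> is_iso psi ->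
  f' ∘ fi = psi ∘ f -> b' ∘ th = psi ∘ b ->
  (forall i, pi' i ∘ th = fi ∘ pi i) ->
  is_fibre_power f b pi -> is_fibre_power f' b' pi' -> is_iso th.
Proof.
move=> ifi ipsi ef eb epi fP fP'.
have [fi' [fi1 fi2]] := ifi; have [ps' [ps1 ps2]] := ipsi.
have [i|h [[hb hp] _]] :=
  @ifp_univ _ _ _ _ _ _ _ _ fP P' (ps' ∘ b') (fun i => fi' ∘ pi' i).
  apply: (iso_mono ipsi).
  by rewrite !compmA -ef (rea fi2) compm1 ps2 comp1m (ifp_comm fP').
exists h; split.
- apply: (ifp_uniq fP); first by rewrite compmA hb -compmA eb compmA ps1 comp1m compm1.
  by move=> i; rewrite compmA hp -compmA epi compmA fi1 comp1m compm1.
- apply: (ifp_uniq fP'); first by rewrite compmA eb -compmA hb compmA ps2 comp1m compm1.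
  by move=> i; rewrite compmA epi -compmA hp compmA fi2 comp1m compm1.
Qed.

Lemma eqz_iso (E A B E' A' B' : D) (e : E ~> A) (f g : A ~> B)
  (e' : E' ~> A') (f' g' : A' ~> B') (th : E ~> E') (fi : A ~> A') (psi : B ~> B') :
  is_iso th -> is_iso fi -> is_iso psi ->
  e' ∘ th = fi ∘ e -> f' ∘ fi = psi ∘ f -> g' ∘ fi = psi ∘ g ->
  is_equalizer e f g -> is_equalizer e' f' g'.
Proof.
move=> ith ifi ipsi ee ef eg [eq U].
have [fi' [fi1 fi2]] := ifi; have [th' [th1 th2]] := ith.
split.
  apply: (iso_epi ith); rewrite -!compmA ee !compmA ef eg -!compmA.
  by rewrite eq.
move=> Z z ez.
have [|h [he hu]] := U Z (fi' ∘ z).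
  apply: (iso_mono ipsi).
  by rewrite !compmA -ef -eg !(rea fi2) !compm1 ez.
exists (th ∘ h); split; first by rewrite compmA ee -compmA he compmA fi2 comp1m.
move=> k ek; rewrite (hu (th' ∘ k)); first by rewrite compmA th2 comp1m.
apply: (iso_mono ifi).
by rewrite !compmA -ee (rea th2) compm1 fi2 comp1m.
Qed.

Lemma iso_square_rev (X Y X' Y' : D) (h : X ~> Y) (h' : X' ~> Y')
  (a : X ~> X') (b : Y ~> Y') (a' : X' ~> X) (b' : Y' ~> Y) :
  is_inverse a a' -> is_inverse b b' -> h' ∘ a = b ∘ h -> h ∘ a' = b' ∘ h'.
Proof.
move=> [a1 a2] [b1 b2] e.
by rewrite -(compm1 h') -a2 !compmA (rea e) !compmA b1 comp1m.
Qed.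

Lemma eqz_iso_rev (E A B E' A' B' : D) (e : E ~> A) (f g : A ~> B)
  (e' : E' ~> A') (f' g' : A' ~> B') (th : E ~> E') (fi : A ~> A') (psi : B ~> B') :
  is_iso th -> is_iso fi -> is_iso psi ->
  e' ∘ th = fi ∘ e -> f' ∘ fi = psi ∘ f -> g' ∘ fi = psi ∘ g ->
  is_equalizer e' f' g' -> is_equalizer e f g.
Proof.
move=> [th' hth] [fi' hfi] [ps' hps] ee ef eg.
apply: (eqz_iso (th := th') (fi := fi') (psi := ps')).
- by exists th; split; case: hth.
- by exists fi; split; case: hfi.
- by exists psi; split; case: hps.
- exact: iso_square_rev hth hfi ee.
- exact: iso_square_rev hfi hps ef.
- exact: iso_square_rev hfi hps eg.
Qed.

Lemma is_iso_inverse (X Y : D) (f : X ~> Y) (g : Y ~> X) :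
  is_inverse f g -> is_iso g.
Proof. by case=> a b; exists f. Qed.

End FibrePowerTheory.

Lemma fmap_iso (D D' : Category) (H : Functor D D') (X Y : D) (f : X ~> Y) :
  is_iso f -> is_iso (fmap H f).
Proof. by case=> g [a b]; exists (fmap H g); split; rewrite -fmapM ?a ?b fmap1. Qed.

Definition powF (D : Category) (T : Functor D D) (p : NatTrans T (idF D))
  (n : nat) (pow : forall A : D, FibrePower n (p A : T A ~> A)) : Functor D D.
Proof.
unshelve refine (@MkFunctor D D (fun A => fp_ob (pow A))
  (fun A B f => fp_tuple (pow B) (z := f ∘ fp_base (pow A))
                  (x := fun i => fmap T f ∘ fp_proj (pow A) i) _) _ _).
- abstract (by move=> i; rewrite compmA (naturality p f) -compmA (ifp_comm (fpP (pow A)))).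
- abstract (by move=> A; apply: (ifp_uniq (fpP (pow A))) => [|i];
    rewrite ?fp_tuple_base ?fp_tuple_proj ?fmap1 comp1m compm1).
- abstract (by move=> A B E g f; apply: (ifp_uniq (fpP (pow E))) => [|i];
    rewrite compmA ?fp_tuple_base ?fp_tuple_proj ?fmapM -!compmA
            ?fp_tuple_base ?fp_tuple_proj).
Defined.

Fixpoint iterF (D : Category) (T : Functor D D) (m : nat) : Functor D D :=
  if m is m'.+1 then compF (iterF T m') T else idF D.

Definition i3_0 : 'I_3 := @Ordinal 3 0 isT.
Definition i3_1 : 'I_3 := @Ordinal 3 1 isT.
Definition i3_2 : 'I_3 := @Ordinal 3 2 isT.

(* In the axioms, an arrow [u] with [is_pair _ u x y] is the arrow <x, y>
   induced by the universal property: in each case its codomain carries a binary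
   fibre power on which [x] and [y] form a cone, so [u] exists and is unique. *)
Record TangentStructure (D : Category) : Type := MkTangentStructure {
  tT : Functor D D;
  tp : NatTrans tT (idF D);
  tpow : forall (n : nat) (A : D), FibrePower n (tp A : tT A ~> A);
  tpow_pres : forall (n m : nat) (A : D),
    preserves_fibre_power (iterF tT m) (tpow n A);
  t0 : NatTrans (idF D) tT;
  tadd : NatTrans (powF (tpow 2)) tT;
  tl : NatTrans tT (compF tT tT);
  tc : NatTrans (compF tT tT) (compF tT tT);
  tp_0 : forall A : D, tp A ∘ t0 A = idm A;
  tp_add : forall A : D, tp A ∘ tadd A = fp_base (tpow 2 A);
  taddA : forall (A : D) (u v l r : tpow 3 A ~> tpow 2 A),
    is_pair (fp_proj (tpow 2 A)) u
      (fp_proj (tpow 3 A) i3_0) (fp_proj (tpow 3 A) i3_1) ->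
    is_pair (fp_proj (tpow 2 A)) v
      (fp_proj (tpow 3 A) i3_1) (fp_proj (tpow 3 A) i3_2) ->
    is_pair (fp_proj (tpow 2 A)) l (tadd A ∘ u) (fp_proj (tpow 3 A) i3_2) ->
    is_pair (fp_proj (tpow 2 A)) r (fp_proj (tpow 3 A) i3_0) (tadd A ∘ v) ->
    tadd A ∘ l = tadd A ∘ r;
  tadd0 : forall (A : D) (u : tT A ~> tpow 2 A),
    is_pair (fp_proj (tpow 2 A)) u (idm (tT A)) (t0 A ∘ tp A) ->
    tadd A ∘ u = idm (tT A);
  taddC : forall (A : D) (u : tpow 2 A ~> tpow 2 A),
    is_pair (fp_proj (tpow 2 A)) u
      (fp_proj (tpow 2 A) ord_max) (fp_proj (tpow 2 A) ord0) ->
    tadd A ∘ u = tadd A;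
  tl_p : forall A : D, fmap tT (tp A) ∘ tl A = t0 A ∘ tp A;
  tl_add : forall (A : D) (u : tpow 2 A ~> tT (tpow 2 A)),
    is_pair (fun i => fmap tT (fp_proj (tpow 2 A) i)) u
      (tl A ∘ fp_proj (tpow 2 A) ord0) (tl A ∘ fp_proj (tpow 2 A) ord_max) ->
    tl A ∘ tadd A = fmap tT (tadd A) ∘ u;
  tl_0 : forall A : D, tl A ∘ t0 A = fmap tT (t0 A) ∘ t0 A;
  tc_p : forall A : D, tp (tT A) ∘ tc A = fmap tT (tp A);
  tc_add : forall (A : D) (u : tT (tpow 2 A) ~> tpow 2 (tT A)),
    is_pair (fp_proj (tpow 2 (tT A))) u
      (tc A ∘ fmap tT (fp_proj (tpow 2 A) ord0))
      (tc A ∘ fmap tT (fp_proj (tpow 2 A) ord_max)) ->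
    tc A ∘ fmap tT (tadd A) = tadd (tT A) ∘ u;
  tc_0 : forall A : D, tc A ∘ fmap tT (t0 A) = t0 (tT A);
  tcc : forall A : D, tc A ∘ tc A = idm (tT (tT A));
  tc_l : forall A : D, tc A ∘ tl A = tl A;
  tl_l : forall A : D, fmap tT (tl A) ∘ tl A = tl (tT A) ∘ tl A;
  tc_braid : forall A : D,
    tc (tT A) ∘ fmap tT (tc A) ∘ tc (tT A)
    = fmap tT (tc A) ∘ tc (tT A) ∘ fmap tT (tc A);
  tc_tl : forall A : D,
    tc (tT A) ∘ fmap tT (tc A) ∘ tl (tT A) = fmap tT (tl A) ∘ tc A;
  tl_univ : forall (A : D) (u : tpow 2 A ~> tT (tpow 2 A)),
    is_pair (fun i => fmap tT (fp_proj (tpow 2 A) i)) u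
      (tl A ∘ fp_proj (tpow 2 A) ord0) (t0 (tT A) ∘ fp_proj (tpow 2 A) ord_max) ->
    is_equalizer (fmap tT (tadd A) ∘ u)
      (fmap tT (tp A)) (t0 A ∘ tp A ∘ tp (tT A))
}.

Record TangentCategory : Type := MkTangentCategory {
  tcat :> Category;
  tstr : TangentStructure tcat
}.

Record is_tangent_morphism (D E : Category) (TD : TangentStructure D)
  (TE : TangentStructure E) (H : Functor D E)
  (al : NatTrans (compF H (tT TD)) (compF (tT TE) H)) : Prop :=
  MkIsTangentMorphism {
  tm_p : forall A : D, tp TE (H A) ∘ al A = fmap H (tp TD A);
  tm_0 : forall A : D, al A ∘ fmap H (t0 TD A) = t0 TE (H A);
  tm_add : forall (A : D) (u : H (tpow TD 2 A) ~> tpow TE 2 (H A)),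
    is_pair (fp_proj (tpow TE 2 (H A))) u
      (al A ∘ fmap H (fp_proj (tpow TD 2 A) ord0))
      (al A ∘ fmap H (fp_proj (tpow TD 2 A) ord_max)) ->
    al A ∘ fmap H (tadd TD A) = tadd TE (H A) ∘ u;
  tm_l : forall A : D,
    tl TE (H A) ∘ al A
    = fmap (tT TE) (al A) ∘ al (tT TD A) ∘ fmap H (tl TD A);
  tm_c : forall A : D,
    tc TE (H A) ∘ fmap (tT TE) (al A) ∘ al (tT TD A)
    = fmap (tT TE) (al A) ∘ al (tT TD A) ∘ fmap H (tc TD A)
}.

Record is_strong (D E : Category) (TD : TangentStructure D)
  (TE : TangentStructure E) (H : Functor D E)
  (al : NatTrans (compF H (tT TD)) (compF (tT TE) H)) : Prop := MkIsStrong {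
  st_iso : forall A : D, is_iso (al A);
  st_pow : forall (n : nat) (A : D), preserves_fibre_power H (tpow TD n A);
  st_univ : forall (A : D) (u : tpow TD 2 A ~> tT TD (tpow TD 2 A)),
    is_pair (fun i => fmap (tT TD) (fp_proj (tpow TD 2 A) i)) u
      (tl TD A ∘ fp_proj (tpow TD 2 A) ord0)
      (t0 TD (tT TD A) ∘ fp_proj (tpow TD 2 A) ord_max) ->
    is_equalizer (fmap H (fmap (tT TD) (tadd TD A) ∘ u))
      (fmap H (fmap (tT TD) (tp TD A)))
      (fmap H (t0 TD A ∘ tp TD A ∘ tp TD (tT TD A)))
}.

Record TangentMorphism (D E : TangentCategory) : Type := MkTangentMorphism {
  tm_fun :> Functor D E;
  tm_nat : NatTrans (compF tm_fun (tT (tstr D))) (compF (tT (tstr E)) tm_fun);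
  tmP : is_tangent_morphism (TD := tstr D) (TE := tstr E) tm_nat
}.
Arguments tm_nat {D E} t.

Record TangentTransformation (D E : TangentCategory)
  (H K : TangentMorphism D E) : Type := MkTangentTransformation {
  tt_nat :> NatTrans H K;
  ttP : forall A : D,
    fmap (tT (tstr E)) (tt_nat A) ∘ tm_nat H A
    = tm_nat K A ∘ tt_nat (tT (tstr D) A)
}.
Lemma TangentTransformation_eq (D E : TangentCategory)
  (H K : TangentMorphism D E) (a b : TangentTransformation H K) :
  (forall A, a A = b A) -> a = b.
Proof.
case: a b => [a pa] [b pb] /= e.
have e' : a = b by apply: nat_ext.
by subst b; f_equal; apply: proof_irrelevance.
Qed.

Lemma tadd_pair_map (D E : TangentCategory) (H : TangentMorphism D E) (A : D) :
  exists u : H (tpow (tstr D) 2 A) ~> tpow (tstr E) 2 (H A),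
    is_pair (fp_proj (tpow (tstr E) 2 (H A))) u
      (tm_nat H A ∘ fmap H (fp_proj (tpow (tstr D) 2 A) ord0))
      (tm_nat H A ∘ fmap H (fp_proj (tpow (tstr D) 2 A) ord_max)).
Proof.
apply: (ifp_pair (fpP (tpow (tstr E) 2 (H A)))).
by rewrite !compmA (tm_p (tmP H)) -!fmapM !(ifp_comm (fpP (tpow (tstr D) 2 A))).
Qed.

Definition idTM_nat (D : TangentCategory) :
  NatTrans (compF (idF D) (tT (tstr D))) (compF (tT (tstr D)) (idF D)).
Proof.
refine (@MkNatTrans _ _ (compF (idF D) (tT (tstr D))) (compF (tT (tstr D)) (idF D))
          (fun A => idm (tT (tstr D) A)) _).
abstract (by move=> A B f; rewrite comp1m compm1).
Defined.

Lemma idTM_P (D : TangentCategory) :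
  @is_tangent_morphism D D (tstr D) (tstr D) (idF D) (idTM_nat D).
Proof.
split=> [A|A|A u [u0 u1]|A|A] /=; rewrite ?comp1m ?fmap1 ?comp1m ?compm1 //.
move: u0 u1; rewrite /= !comp1m => u0 u1.
rewrite (_ : u = idm _) ?compm1 //.
by apply: (ifp_uniq2 (fpP (tpow (tstr D) 2 A))); rewrite ?u0 ?u1 compm1.
Qed.

Definition idTM (D : TangentCategory) : TangentMorphism D D :=
  MkTangentMorphism (idTM_P D).

Definition compTM_nat (D E G : TangentCategory)
  (K : TangentMorphism E G) (H : TangentMorphism D E) :
  NatTrans (compF (compF K H) (tT (tstr D))) (compF (tT (tstr G)) (compF K H)).
Proof.
refine (@MkNatTrans _ _ (compF (compF K H) (tT (tstr D)))
          (compF (tT (tstr G)) (compF K H))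
          (fun A => tm_nat K (H A) ∘ fmap K (tm_nat H A)) _).
abstract (by move=> A B f;
  rewrite /= -compmA -fmapM (naturality (tm_nat H) f) /= fmapM compmA
          (naturality (tm_nat K) (fmap H f)) compmA).
Defined.

Lemma compTM_P (D E G : TangentCategory)
  (K : TangentMorphism E G) (H : TangentMorphism D E) :
  @is_tangent_morphism D G (tstr D) (tstr G) (compF K H) (compTM_nat K H).
Proof.
have nK A := naturality (tm_nat K) (tm_nat H A).
split=> [A|A|A u [u0 u1]|A|A] /=.
- by rewrite compmA (tm_p (tmP K)) -(fmapM K) (tm_p (tmP H)).
- by rewrite -compmA -fmapM (tm_0 (tmP H)) (tm_0 (tmP K)).
- have [v v01] := tadd_pair_map H A; have [v0 v1] := v01.
  have [w w01] := tadd_pair_map K (H A); have [w0 w1] := w01.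
  rewrite -compmA -(fmapM K) (tm_add (tmP H) v01) fmapM compmA (tm_add (tmP K) w01).
  rewrite -compmA; congr (_ ∘ _).
  apply: (ifp_uniq2 (fpP (tpow (tstr G) 2 (K (H A))))).
  + by rewrite u0 compmA w0 -[in LHS]compmA -(fmapM K) v0 fmapM compmA.
  + by rewrite u1 compmA w1 -[in LHS]compmA -(fmapM K) v1 fmapM compmA.
- rewrite compmA (tm_l (tmP K)) /= -(compmA _ (fmap K _)) -(fmapM K) (tm_l (tmP H)) !fmapM !compmA.
  by rewrite (rea (nK A)) /= !compmA.
- rewrite !fmapM !compmA (rea (esym (nK A))) /= !compmA (tm_c (tmP K)).
  have cH := f_equal (fun z => fmap K z) (tm_c (tmP H) A).
  rewrite /= !fmapM in cH.
  by rewrite (rea3 cH) !compmA /= (rea (nK A)) /= !compmA.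
Qed.

Definition compTM (D E G : TangentCategory)
  (K : TangentMorphism E G) (H : TangentMorphism D E) : TangentMorphism D G :=
  MkTangentMorphism (compTM_P K H).

Definition idTT (D E : TangentCategory) (H : TangentMorphism D E) :
  TangentTransformation H H.
Proof.
refine (@MkTangentTransformation D E H H (idN H) _).
abstract (by move=> A; rewrite /= fmap1 comp1m compm1).
Defined.

Definition compTT (D E : TangentCategory) (H K L : TangentMorphism D E)
  (b : TangentTransformation K L) (a : TangentTransformation H K) :
  TangentTransformation H L.
Proof.
refine (@MkTangentTransformation D E H L (compN b a) _).
abstract (by move=> A; rewrite /= fmapM -compmA (ttP a A) !compmA /= (ttP b A)).
Defined.

Definition lwhiskTT (D E G : TangentCategory) (L : TangentMorphism E G)
  (H K : TangentMorphism D E) (a : TangentTransformation H K) :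
  TangentTransformation (compTM L H) (compTM L K).
Proof.
refine (@MkTangentTransformation D G (compTM L H) (compTM L K) (lwhiskN L a) _).
abstract (by move=> A;
  rewrite /= compmA -(naturality (tm_nat L) (a A)) /= -!compmA -!(fmapM L) (ttP a A)).
Defined.

Definition rwhiskTT (D E G : TangentCategory) (L M : TangentMorphism E G)
  (b : TangentTransformation L M) (H : TangentMorphism D E) :
  TangentTransformation (compTM L H) (compTM M H).
Proof.
refine (@MkTangentTransformation D G (compTM L H) (compTM M H) (rwhiskN b H) _).
abstract (by move=> A;
  rewrite /= compmA (ttP b) -!compmA (naturality b (tm_nat H A))).
Defined.

Definition TanData : TwoCategoryData :=
  @MkTwoCategoryData TangentCategory TangentMorphism TangentTransformation
    idTM compTM idTT compTT lwhiskTT rwhiskTT.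

Lemma coe_Tan (D E : TanData) (H K : hom1 D E) (e : H = K) (A : Ob (tcat D)) :
  (coe e : TangentTransformation H K) A
  = eqhom (f_equal (fun M : TangentMorphism D E => M A) e).
Proof. by case: K / e. Qed.

Lemma TangentMorphism_eq (D E : TangentCategory) (H K : TangentMorphism D E)
  (e : tm_fun H = tm_fun K) :
  (forall A, fmap (tT (tstr E)) (eqhom (f_equal (fun M : Functor D E => M A) e))
               ∘ tm_nat H A
             = tm_nat K A ∘ eqhom (f_equal (fun M : Functor D E => M (tT (tstr D) A)) e)) ->
  H = K.
Proof.
case: H K e => [H a pa] [K b pb] /= e; subst K => /= h.
have e' : a = b by apply: nat_ext => A; have := h A; rewrite fmap1 comp1m compm1.
by subst b; f_equal; apply: proof_irrelevance.
Qed.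

Lemma compTMA (A B C D : TangentCategory) (H : TangentMorphism C D)
  (G : TangentMorphism B C) (F : TangentMorphism A B) :
  compTM H (compTM G F) = compTM (compTM H G) F.
Proof.
apply: (@TangentMorphism_eq _ _ (compTM H (compTM G F)) (compTM (compTM H G) F)
  (compFA H G F)) => X /=.
by rewrite !eqhom_id /= fmap1 comp1m compm1 fmapM compmA.
Qed.

Lemma compTM1l (A B : TangentCategory) (F : TangentMorphism A B) :
  compTM (idTM B) F = F.
Proof.
apply: (@TangentMorphism_eq _ _ (compTM (idTM B) F) F (compF1l F)) => X /=.
by rewrite !eqhom_id /= fmap1 !comp1m compm1.
Qed.

Lemma compTM1r (A B : TangentCategory) (F : TangentMorphism A B) :
  compTM F (idTM A) = F.
Proof.
apply: (@TangentMorphism_eq _ _ (compTM F (idTM A)) F (compF1r F)) => X /=.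
by rewrite !eqhom_id /= !fmap1 comp1m.
Qed.

Definition Tan : TwoCategory.
Proof.
refine (@MkTwoCategory TanData compTMA compTM1l compTM1r _ _ _ _ _ _ _ _ _ _ _ _ _);
  abstract (by intros; apply: TangentTransformation_eq => X;
    rewrite /= ?coe_Tan ?eqhom_id /=
            ?compmA ?comp1m ?compm1 ?fmap1 ?fmapM ?naturality).
Defined.

Definition strong (D E : Tan) (H : hom1 D E) : Prop :=
  is_strong (TD := tstr D) (TE := tstr E) (tm_nat (H : TangentMorphism D E)).

Lemma strong_id (D : Tan) : strong (id1 D).
Proof.
split=> [A|n A|A u h] /=.
- exact: is_iso_id.
- exact: (fpP (tpow (tstr D) n A)).
- exact: tl_univ.
Qed.

Lemma strong_comparison (D E : TangentCategory) (H : TangentMorphism D E) n A :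
  is_strong (tm_nat H) ->
  exists th : H (tpow (tstr D) n A) ~> tpow (tstr E) n (H A),
    [/\ is_iso th,
        fp_base (tpow (tstr E) n (H A)) ∘ th = fmap H (fp_base (tpow (tstr D) n A))
      & forall i, fp_proj (tpow (tstr E) n (H A)) i ∘ th
                  = tm_nat H A ∘ fmap H (fp_proj (tpow (tstr D) n A) i)].
Proof.
move=> sH; set P := tpow (tstr D) n A; set Q := tpow (tstr E) n (H A).
have e i : tp (tstr E) (H A) ∘ (tm_nat H A ∘ fmap H (fp_proj P i)) = fmap H (fp_base P).
  by rewrite compmA (tm_p (tmP H)) -fmapM (ifp_comm (fpP P)).
exists (fp_tuple Q e); split; [|exact: fp_tuple_base|exact: fp_tuple_proj].
apply: (ifp_comparison (st_iso sH A) (is_iso_id (H A)) _ _ _ (st_pow sH n A) (fpP Q)).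
- by rewrite comp1m; exact: (tm_p (tmP H)).
- by rewrite comp1m fp_tuple_base.
- by move=> i; rewrite fp_tuple_proj.
Qed.

Lemma strong_comp (D E G : Tan) (K : hom1 E G) (H : hom1 D E) :
  strong K -> strong H -> strong (K ⋅ H).
Proof.
rewrite /strong /= => sK sH; split=> [A|n A|A u hu] /=.
- exact: is_iso_comp (st_iso sK (H A)) (fmap_iso K (st_iso sH A)).
- have [th [ith eb ep]] := strong_comparison n A sH.
  have [al' ial'] := st_iso sH A; have [th' ith'] := ith.
  apply: (ifp_iso (fi := fmap K al') (psi := idm _) (th := fmap K th') _ _ _ _ _ _
            (st_pow sK n (H A))) => /=.
  + by apply: fmap_iso; exact: is_iso_inverse ial'.
  + exact: is_iso_id.
  + by apply: fmap_iso; exact: is_iso_inverse ith'.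
  + rewrite -fmapM comp1m -(tm_p (tmP H)); congr (fmap K _).
    by rewrite -compmA (proj2 ial') compm1.
  + rewrite comp1m -fmapM -eb; congr (fmap K _).
    by rewrite -compmA (proj2 ith') compm1.
  + move=> i; rewrite -!fmapM; congr (fmap K _).
    apply: (iso_mono (st_iso sH A)).
    by rewrite !compmA -ep (rea (proj2 ith')) compm1 (proj2 ial') comp1m.
- set S := tT (tstr E); set T := tT (tstr D).
  have [th [ith eb ep]] := strong_comparison 2 A sH.
  set P := tpow (tstr D) 2 A in th ith eb ep u hu *.
  set Q := tpow (tstr E) 2 (H A) in th ith eb ep *.
  have [u0 u1] := hu.
  have [v hv] : exists v : Q ~> S Q, is_pair (fun i => fmap S (fp_proj Q i)) v
      (tl (tstr E) (H A) ∘ fp_proj Q ord0)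
      (t0 (tstr E) (S (H A)) ∘ fp_proj Q ord_max).
    apply: (ifp_pair (tpow_pres (tstr E) 2 1 (H A))) => /=.
    rewrite !compmA -/S tl_p -(naturality (t0 (tstr E)) (tp (tstr E) (H A))) /=.
    by rewrite -!compmA !(ifp_comm (fpP Q)).
  have [v0 v1] := hv.
  have nH i : tm_nat H (T A) ∘ fmap H (fmap T (fp_proj P i))
      = fmap S (fmap H (fp_proj P i)) ∘ tm_nat H P := naturality (tm_nat H) _.
  have hvth i : fmap S (fp_proj Q i) ∘ (fmap S th ∘ tm_nat H P ∘ fmap H u)
      = fmap S (tm_nat H A) ∘ tm_nat H (T A) ∘ fmap H (fmap T (fp_proj P i) ∘ u).
    by rewrite !compmA -(fmapM S) ep !fmapM (rea (esym (nH i))) /= !compmA.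
  have vth : v ∘ th = fmap S th ∘ tm_nat H P ∘ fmap H u.
    apply: (ifp_uniq2 (tpow_pres (tstr E) 2 1 (H A))) => /=.
    + rewrite (hvth ord0) u0 compmA v0 -(compmA _ _ th) ep.
      by rewrite fmapM !compmA (tm_l (tmP H)).
    + rewrite (hvth ord_max) u1 compmA v1 -(compmA _ _ th) ep.
      rewrite fmapM !compmA (rea (tm_0 (tmP H) _)).
      by rewrite -(naturality (t0 (tstr E)) (tm_nat H A)).
  have nTa := naturality (tm_nat H).
  apply: (eqz_iso_rev (th := fmap K th)
            (fi := fmap K (fmap S (tm_nat H A) ∘ tm_nat H (T A)))
            (psi := fmap K (tm_nat H A)) _ _ _ _ _ _ (st_univ sK hv)).
  + exact: fmap_iso.
  + apply: fmap_iso; apply: is_iso_comp; last exact: (st_iso sH).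
    by apply: fmap_iso; exact: (st_iso sH).
  + by apply: fmap_iso; exact: (st_iso sH).
  + rewrite -!(fmapM K); congr (fmap K _).
    rewrite -(compmA _ v) vth fmapM !compmA.
    have nadd : tm_nat H (T A) ∘ fmap H (fmap T (tadd (tstr D) A))
      = fmap S (fmap H (tadd (tstr D) A)) ∘ tm_nat H P := naturality (tm_nat H) _.
    rewrite (rea nadd) !compmA -!(fmapM S) (@tm_add _ _ _ _ _ _ (tmP H) A th) //.
  + rewrite -!(fmapM K); congr (fmap K _).
    rewrite compmA -(fmapM S) (tm_p (tmP H)).
    exact: esym (naturality (tm_nat H) (tp (tstr D) A)).
  + rewrite -!(fmapM K); congr (fmap K _).
    rewrite !fmapM !compmA (tm_0 (tmP H)) -!(compmA (t0 _ _)); congr (_ ∘ _).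
    rewrite -(tm_p (tmP H)) -(tm_p (tmP H)) !compmA.
    have np : tp (tstr E) (H A) ∘ tp (tstr E) (S (H A)) ∘ fmap S (tm_nat H A)
       = tp (tstr E) (H A) ∘ (tm_nat H A ∘ tp (tstr E) (H (T A))).
      by rewrite -compmA (naturality (tp (tstr E)) (tm_nat H A)).
    by rewrite np !compmA.
Qed.

Definition Tan_strong : TwoCategory := Sub2 strong_id strong_comp.
Definition fibre (C : Category) (F : PseudoFunctor C Cat) (X : C) : Category :=
  F X.

Definition reindex (C : Category) (F : PseudoFunctor C Cat) (X Y : C)
  (f : X ~> Y) : Functor (fibre F Y) (fibre F X) := pf1 F f.

Definition compositor (C : Category) (F : PseudoFunctor C Cat) (X Y Z : C)
  (f : X ~> Y) (g : Y ~> Z) :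
  NatTrans (compF (reindex F f) (reindex F g)) (reindex F (g ∘ f)) := pf2 F f g.

(* [tif_inv F f] is the inverse of [tif_nat F f]; these inverses, and not the
   [tif_nat F f] themselves, are the 2-cells of the pseudonatural transformation. *)
Record TangentIndexingFunctor (C : Category) : Type :=
  MkTangentIndexingFunctor {
  tif_fun :> PseudoFunctor C Cat;
  tif_str : forall X : C, TangentStructure (fibre tif_fun X);
  tif_nat : forall (X Y : C) (f : X ~> Y),
    NatTrans (compF (reindex tif_fun f) (tT (tif_str Y)))
             (compF (tT (tif_str X)) (reindex tif_fun f));
  tif_inv : forall (X Y : C) (f : X ~> Y),
    NatTrans (compF (tT (tif_str X)) (reindex tif_fun f))
             (compF (reindex tif_fun f) (tT (tif_str Y)));
  tif_invP : forall (X Y : C) (f : X ~> Y) (A : fibre tif_fun Y),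
    is_inverse (tif_nat f A) (tif_inv f A);
  tif_mor : forall (X Y : C) (f : X ~> Y), is_tangent_morphism (tif_nat f);
  tif_strong : forall (X Y : C) (f : X ~> Y), is_strong (tif_nat f);
  tif_pseudonat :
    is_pseudonat (D := tif_fun) (E := tif_fun)
      (t1 := fun X => tT (tif_str X)) tif_inv
}.

Arguments tif_str {C} t X.
Arguments tif_nat {C} t {X Y} f.
Arguments tif_inv {C} t {X Y} f.
Arguments tif_invP {C} t {X Y} f A.
Arguments tif_mor {C} t {X Y} f.
Arguments tif_strong {C} t {X Y} f.
Arguments tif_pseudonat {C} t.

Lemma eqhom_comp (C : Category) (A B D : C) (e : A = B) (e' : B = D) :
  eqhom e' ∘ eqhom e = eqhom (etrans e e').
Proof. by case: D / e'; case: B / e; rewrite comp1m. Qed.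

Lemma eqhom_irr (C : Category) (A B : C) (e e' : A = B) : eqhom e = eqhom e'.
Proof. by rewrite (proof_irrelevance _ e e'). Qed.

Lemma fmap_eqhom (C D : Category) (F : Functor C D) (A B : C) (e : A = B) :
  fmap F (eqhom e) = eqhom (f_equal F e).
Proof. by case: B / e; rewrite fmap1. Qed.

Lemma Cat_inv (C D : Cat) (F G : hom1 C D) (a : hom2 F G) :
  invertible2 a -> forall A, is_iso ((a : NatTrans F G) A).
Proof.
case=> b [e1 e2] A; exists ((b : NatTrans G F) A); split.
- exact: (f_equal (fun n : NatTrans F F => n A) e1).
- exact: (f_equal (fun n : NatTrans G G => n A) e2).
Qed.

Lemma Tan_inv (D E : TangentCategory) (H K : TangentMorphism D E)
  (a : TangentTransformation H K) :
  (forall A, is_iso (a A)) -> @invertible2 Tan D E H K a.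
Proof.
move=> ia.
pose b A := proj1_sig (constructive_indefinite_description _ (ia A)).
have bP A : is_inverse (a A) (b A).
  by rewrite /b; case: constructive_indefinite_description.
have nb A B (f : A ~> B) : b B ∘ fmap K f = fmap H f ∘ b A.
  apply: (iso_epi (ia A)).
  rewrite -compmA -(naturality a f) compmA (proj1 (bP B)) comp1m.
  by rewrite -compmA (proj1 (bP A)) compm1.
have tb A : fmap (tT (tstr E)) (b A) ∘ tm_nat K A
  = tm_nat H A ∘ b (tT (tstr D) A).
  apply: (iso_epi (ia _)).
  rewrite -compmA -(ttP a A) compmA -fmapM (proj1 (bP A)) fmap1 comp1m.
  by rewrite -compmA (proj1 (bP _)) compm1.
exists (@MkTangentTransformation D E K H (MkNatTrans nb) tb); split.
- by apply: TangentTransformation_eq => A; exact: (proj1 (bP A)).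
- by apply: TangentTransformation_eq => A; exact: (proj2 (bP A)).
Qed.

Section AssociatedPseudoFunctor.
Variables (C : Category) (F : TangentIndexingFunctor C).

Definition tif_ob (X : C) : TangentCategory := MkTangentCategory (tif_str F X).

Definition tif_TM (X Y : C) (f : X ~> Y) : TangentMorphism (tif_ob Y) (tif_ob X) :=
  @MkTangentMorphism (tif_ob Y) (tif_ob X) (reindex F f) (tif_nat F f) (tif_mor F f).

Lemma tif_pn_comp (X Y Z : C) (f : X ~> Y) (g : Y ~> Z) (A : fibre F Z) :
  tif_inv F (g ∘ f) A ∘ fmap (tT (tif_str F X)) (compositor F f g A)
  = compositor F f g (tT (tif_str F Z) A)
    ∘ fmap (reindex F f) (tif_inv F g A) ∘ tif_inv F f (reindex F g A).
Proof.
have := f_equal (fun n : NatTrans _ _ => n A) (pn_comp (tif_pseudonat F) f g).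
by rewrite /= !coe_Cat !eqhom_id /= !compm1.
Qed.

Lemma tif_comp_TT (X Y Z : C) (f : X ~> Y) (g : Y ~> Z) (A : fibre F Z) :
  fmap (tT (tif_str F X)) (compositor F f g A)
    ∘ tm_nat (compTM (tif_TM f) (tif_TM g)) A
  = tm_nat (tif_TM (g ∘ f)) A ∘ compositor F f g (tT (tif_str F Z) A).
Proof.
have [a1 a2] := tif_invP F (g ∘ f) A.
have [b1 b2] := tif_invP F f (reindex F g A).
have [c1 c2] := tif_invP F g A.
apply: (iso_mono (is_iso_inverse (conj a1 a2))) => /=.
rewrite !compmA a1 tif_pn_comp comp1m (rea b1) compm1.
by rewrite -compmA -fmapM c1 fmap1 compm1.
Qed.

Definition tif_TT (X Y Z : C) (f : X ~> Y) (g : Y ~> Z) :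
  TangentTransformation (compTM (tif_TM f) (tif_TM g)) (tif_TM (g ∘ f)) :=
  @MkTangentTransformation _ _ (compTM (tif_TM f) (tif_TM g)) (tif_TM (g ∘ f))
    (compositor F f g) (tif_comp_TT f g).

Lemma tif_TM_id (X : C) : tif_TM (idm X) = idTM (tif_ob X).
Proof.
apply: (@TangentMorphism_eq _ _ (tif_TM (idm X)) (idTM (tif_ob X)) (pf_id F X)) => A /=.
have [a1 a2] := tif_invP F (idm X) A.
have := f_equal (fun n : NatTrans _ _ => n A) (pn_id (tif_pseudonat F) X).
rewrite /= coe_Cat => e.
rewrite comp1m fmap_eqhom.
apply: (iso_epi (is_iso_inverse (conj a1 a2))).
by rewrite -compmA a2 compm1 e eqhom_comp; apply: eqhom_irr.
Qed.

Definition tif_Tan : PseudoFunctor C Tan.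
Proof.
refine (@MkPseudoFunctor C Tan tif_ob tif_TM tif_TT tif_TM_id _ _ _ _).
- abstract (by move=> X Y Z f g; apply: Tan_inv => A;
    exact: (Cat_inv (pf2_inv F f g) A)).
- abstract (move=> X Y f; apply: TangentTransformation_eq => A; rewrite coe_Tan;
    rewrite /= /compositor pf2_idl coe_Cat; apply: eqhom_irr).
- abstract (move=> X Y f; apply: TangentTransformation_eq => A; rewrite coe_Tan;
    rewrite /= /compositor pf2_idr coe_Cat; apply: eqhom_irr).
- abstract (move=> W X Y Z f g h; apply: TangentTransformation_eq => A /=;
    rewrite !coe_Tan;
    have := f_equal (fun n : NatTrans _ _ => n A) (pf2_assoc F f g h);
    rewrite /= !coe_Cat /= => <-;
    repeat (f_equal; try exact: eqhom_irr)).
Defined.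

Definition tif_Tan_strong : PseudoFunctor C Tan_strong :=
  lift_pf strong_id strong_comp (D := tif_Tan)
    (fun X Y f => tif_strong F f).

End AssociatedPseudoFunctor.
(* The condition that [pc_tau] is trivial at identities follows from the cocycle
   condition: see [pc_tau_id]. *)
Record PCob (C : Category) (F : PseudoFunctor C Cat) : Type := MkPCob {
  pc_ob :> forall X : C, fibre F X;
  pc_tau : forall (X Y : C) (f : X ~> Y), reindex F f (pc_ob Y) ~> pc_ob X;
  pc_iso : forall (X Y : C) (f : X ~> Y), is_iso (pc_tau f);
  pc_cocycle : forall (X Y Z : C) (f : X ~> Y) (g : Y ~> Z),
    pc_tau (g ∘ f) ∘ compositor F f g (pc_ob Z)
    = pc_tau f ∘ fmap (reindex F f) (pc_tau g)
}.
Arguments pc_tau {C F} p {X Y} f.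

Record PChom (C : Category) (F : PseudoFunctor C Cat) (A B : PCob F) : Type :=
  MkPChom {
  pc_hom :> forall X : C, A X ~> B X;
  pc_homP : forall (X Y : C) (f : X ~> Y),
    pc_tau B f ∘ fmap (reindex F f) (pc_hom Y) = pc_hom X ∘ pc_tau A f
}.

Lemma PChom_eq (C : Category) (F : PseudoFunctor C Cat) (A B : PCob F)
  (a b : PChom A B) : (forall X, a X = b X) -> a = b.
Proof.
case: a b => [a pa] [b pb] /= e.
have e' : a = b by apply: functional_extensionality_dep.
by subst b; f_equal; apply: proof_irrelevance.
Qed.

Definition PCid (C : Category) (F : PseudoFunctor C Cat) (A : PCob F) :
  PChom A A.
Proof.
refine (@MkPChom C F A A (fun X => idm (A X)) _).
abstract (by move=> X Y f; rewrite fmap1 comp1m compm1).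
Defined.

Definition PCcomp (C : Category) (F : PseudoFunctor C Cat) (A B D : PCob F)
  (b : PChom B D) (a : PChom A B) : PChom A D.
Proof.
refine (@MkPChom C F A D (fun X => b X ∘ a X) _).
abstract (by move=> X Y f; rewrite fmapM compmA pc_homP -compmA pc_homP compmA).
Defined.

Definition PCcat (C : Category) (F : PseudoFunctor C Cat) : Category.
Proof.
refine (@MkCategory (PCob F) (@PChom C F) (@PCid C F) (@PCcomp C F) _ _ _).
- abstract (by move=> A B D E h g f; apply: PChom_eq => X /=; rewrite compmA).
- abstract (by move=> A B f; apply: PChom_eq => X /=; rewrite comp1m).
- abstract (by move=> A B f; apply: PChom_eq => X /=; rewrite compm1).
Defined.

Section PC.
Variables (C : Category) (F : TangentIndexingFunctor C).
Local Notation PC := (PCcat F).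
Local Notation "'T_' X" := (tT (tif_str F X)) (at level 8, X at level 8) : cat_scope.
Local Notation "f ^*" := (reindex F f) : cat_scope.

Definition PCT_ob (A : PCob F) : PCob F.
Proof.
refine (@MkPCob C F (fun X => T_ X (A X))
  (fun X Y f => fmap T_ X (pc_tau A f) ∘ tif_nat F f (A Y)) _ _).
- abstract (move=> X Y f; apply: is_iso_comp;
    [ apply: fmap_iso; exact: pc_iso | exact: (st_iso (tif_strong F f)) ]).
- abstract (move=> X Y Z f g;
    have n : tif_nat F f (A Y) ∘ fmap f^* (fmap T_ Y (pc_tau A g))
      = fmap T_ X (fmap f^* (pc_tau A g)) ∘ tif_nat F f (reindex F g (A Z))
      := naturality (tif_nat F f) _;
    have h := @tif_comp_TT C F X Y Z f g (A Z);
    rewrite /= in h;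
    rewrite -compmA -h !fmapM !compmA -fmapM pc_cocycle (rea n) !compmA fmapM //).
Defined.

Definition PCT : Functor PC PC.
Proof.
unshelve refine (@MkFunctor PC PC PCT_ob
  (fun A B r => @MkPChom C F (PCT_ob A) (PCT_ob B) (fun X => fmap T_ X (r X)) _) _ _).
- abstract (move=> X Y f /=;
    have n : tif_nat F f (B Y) ∘ fmap f^* (fmap T_ Y (r Y))
      = fmap T_ X (fmap f^* (r Y)) ∘ tif_nat F f (A Y)
      := naturality (tif_nat F f) _;
    by rewrite -compmA n !compmA -!fmapM pc_homP).
- abstract (by move=> A; apply: PChom_eq => X /=; rewrite fmap1).
- abstract (by move=> A B D g f; apply: PChom_eq => X /=; rewrite fmapM).
Defined.

Definition PCp : NatTrans PCT (idF PC).
Proof.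
unshelve refine (@MkNatTrans PC PC PCT (idF PC)
  (fun A => @MkPChom C F (PCT A) A (fun X => tp (tif_str F X) (A X)) _) _).
- abstract (move=> X Y f /=;
    have n := naturality (tp (tif_str F X)) (pc_tau A f);
    by rewrite compmA n -compmA (tm_p (tif_mor F f))).
- abstract (by move=> A B f; apply: PChom_eq => X; exact: (naturality (tp (tif_str F X)))).
Defined.

Lemma PC_ifp (n : nat) (E B P : PC) (f : E ~> B) (b : P ~> B)
  (pi : 'I_n -> (P ~> E)) :
  (forall X, is_fibre_power (pc_hom f X) (pc_hom b X) (fun i => pc_hom (pi i) X)) ->
  is_fibre_power f b pi.
Proof.
move=> fP; split=> [i|Z z x e].
  by apply: PChom_eq => X; exact: (ifp_comm (fP X) i).
have eX X i : pc_hom f X ∘ pc_hom (x i) X = pc_hom z X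
  := f_equal (fun h : PChom Z B => h X) (e i).
pose h X := proj1_sig (constructive_definite_description _ (ifp_univ (fP X) (eX X))).
have [hb hp] : (forall X, pc_hom b X ∘ h X = pc_hom z X) /\
               (forall X i, pc_hom (pi i) X ∘ h X = pc_hom (x i) X).
  by split=> X; rewrite /h; case: constructive_definite_description => k [].
have hP X Y (g : X ~> Y) : pc_tau P g ∘ fmap g^* (h Y) = h X ∘ pc_tau Z g.
  apply: (ifp_uniq (fP X)) => [|i].
  - by rewrite !compmA -pc_homP -compmA -fmapM !hb pc_homP.
  - by rewrite !compmA -pc_homP -compmA -fmapM !hp pc_homP.
exists (MkPChom hP); split; first split.
- by apply: PChom_eq => X; exact: hb.
- by move=> i; apply: PChom_eq => X; exact: hp.
move=> k [kb kp]; apply: PChom_eq => X; apply: (ifp_uniq (fP X)) => [|i] /=.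
- by rewrite hb -(f_equal (fun h : PChom Z B => h X) kb).
- by rewrite hp -(f_equal (fun h : PChom Z E => h X) (kp i)).
Qed.

Lemma PC_eqz (E A B : PC) (e : E ~> A) (f g : A ~> B) :
  (forall X, is_equalizer (pc_hom e X) (pc_hom f X) (pc_hom g X)) ->
  is_equalizer e f g.
Proof.
move=> fP; split=> [|Z z ez].
  by apply: PChom_eq => X; exact: (proj1 (fP X)).
have eX X : pc_hom f X ∘ pc_hom z X = pc_hom g X ∘ pc_hom z X
  := f_equal (fun h : PChom Z B => h X) ez.
pose h X := proj1_sig (constructive_definite_description _ (proj2 (fP X) _ _ (eX X))).
have hE X : pc_hom e X ∘ h X = pc_hom z X.
  by rewrite /h; case: constructive_definite_description.
have mono X W (k k' : W ~> pc_ob E X) : pc_hom e X ∘ k = pc_hom e X ∘ k' -> k = k'.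
  move=> kk'; have [|m [_ um]] := proj2 (fP X) W (pc_hom e X ∘ k').
    by rewrite !compmA (proj1 (fP X)).
  by rewrite -(um k) // -(um k').
have hP X Y (u : X ~> Y) : pc_tau E u ∘ fmap u^* (h Y) = h X ∘ pc_tau Z u.
  by apply: mono; rewrite !compmA -pc_homP -compmA -fmapM !hE pc_homP.
exists (MkPChom hP); split; first by apply: PChom_eq => X; exact: hE.
move=> k ek; apply: PChom_eq => X; apply: mono => /=.
by rewrite hE -(f_equal (fun h : PChom Z A => h X) ek).
Qed.

Lemma pc_cocycle_aux (B : PCob F) (X Y Z : C) (f : X ~> Y) (g : Y ~> Z)
  (W : fibre F Z) (V : fibre F Y) (h : W ~> B Z) (k : V ~> B Y) (t : g^* W ~> V) :
  k ∘ t = pc_tau B g ∘ fmap g^* h ->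
  pc_tau B (g ∘ f) ∘ fmap (reindex F (g ∘ f)) h ∘ compositor F f g W
  = pc_tau B f ∘ fmap f^* k ∘ fmap f^* t.
Proof.
move=> e.
have nphi : fmap (reindex F (g ∘ f)) h ∘ compositor F f g W
    = compositor F f g (B Z) ∘ fmap f^* (fmap g^* h)
  := esym (naturality (compositor F f g) h).
by rewrite (rea nphi) compmA pc_cocycle -!(compmA (pc_tau B f)) -!(fmapM f^*) e.
Qed.

Section Power.
Variables (n : nat) (A : PC).
Let P X := tpow (tif_str F X) n (pc_ob A X).

Lemma PCpow_tau_subproof (X Y : C) (f : X ~> Y) (i : 'I_n) :
  tp (tif_str F X) (pc_ob A X)
    ∘ (pc_tau (PCT_ob A) f ∘ fmap f^* (fp_proj (P Y) i))
  = pc_tau A f ∘ fmap f^* (fp_base (P Y)).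
Proof.
rewrite compmA -(pc_homP (PCp A : PChom (PCT_ob A) A)) -compmA -fmapM.
by rewrite (ifp_comm (fpP (P Y))).
Qed.

Definition PCpow_tau (X Y : C) (f : X ~> Y) : f^* (P Y) ~> P X :=
  fp_tuple (P X) (PCpow_tau_subproof f).

Definition PCpow_ob : PCob F.
Proof.
refine (@MkPCob C F (fun X => fp_ob (P X)) PCpow_tau _ _).
- abstract (move=> X Y f;
    apply: (ifp_comparison (pc_iso (PCT_ob A) f) (pc_iso A f) _ _ _
              (st_pow (tif_strong F f) n (pc_ob A Y)) (fpP (P X)));
    [ exact: esym (pc_homP (PCp A : PChom (PCT_ob A) A) f)
    | exact: fp_tuple_base | exact: fp_tuple_proj ]).
- abstract (move=> X Y Z f g; apply: (ifp_uniq (fpP (P X))) => [|i];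
    rewrite !compmA /PCpow_tau !(fp_tuple_base, fp_tuple_proj);
    [ apply: (pc_cocycle_aux (B := A)) | apply: (pc_cocycle_aux (B := PCT_ob A)) ];
    rewrite ?fp_tuple_base ?fp_tuple_proj //).
Defined.

Definition PCpow_base : PChom PCpow_ob A.
Proof.
refine (@MkPChom C F PCpow_ob A (fun X => fp_base (P X)) _).
abstract (by move=> X Y f; rewrite fp_tuple_base).
Defined.

Definition PCpow_proj (i : 'I_n) : PChom PCpow_ob (PCT_ob A).
Proof.
refine (@MkPChom C F PCpow_ob (PCT_ob A) (fun X => fp_proj (P X) i) _).
abstract (by move=> X Y f; rewrite fp_tuple_proj).
Defined.

(* The fibre powers of PC(F) are computed componentwise. *)
Definition PCpow : FibrePower n (PCp A : PCT A ~> A) :=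
  @MkFibrePower PC n (PCT A) A (PCp A) PCpow_ob PCpow_base PCpow_proj
    (PC_ifp (f := PCp A) (b := PCpow_base) (pi := PCpow_proj)
       (fun X => fpP (P X))).

End Power.

Lemma PC_iter_ifp (m n : nat) (E B P : PC) (f : E ~> B) (b : P ~> B)
  (pi : 'I_n -> (P ~> E)) :
  (forall X, is_fibre_power (fmap (iterF T_ X m) (pc_hom f X))
               (fmap (iterF T_ X m) (pc_hom b X))
               (fun i => fmap (iterF T_ X m) (pc_hom (pi i) X))) ->
  is_fibre_power (fmap (iterF PCT m) f) (fmap (iterF PCT m) b)
    (fun i => fmap (iterF PCT m) (pi i)).
Proof.
elim: m E B P f b pi => [|m IH] E B P f b pi h; first exact: PC_ifp.
exact: (IH _ _ _ (fmap PCT f) (fmap PCT b) (fun i => fmap PCT (pi i)) h).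
Qed.

Definition PC0 : NatTrans (idF PC) PCT.
Proof.
unshelve refine (@MkNatTrans PC PC (idF PC) PCT
  (fun A => @MkPChom C F A (PCT A) (fun X => t0 (tif_str F X) (pc_ob A X)) _) _).
- abstract (move=> X Y f /=;
    have n := naturality (t0 (tif_str F X)) (pc_tau A f);
    by rewrite -compmA (tm_0 (tif_mor F f)) -n).
- abstract (by move=> A B f; apply: PChom_eq => X; exact: (naturality (t0 (tif_str F X)))).
Defined.

Lemma PCadd_subproof (A : PC) (X Y : C) (f : X ~> Y) :
  pc_tau (PCT A : PCob F) f ∘ fmap f^* (tadd (tif_str F Y) (pc_ob A Y))
  = tadd (tif_str F X) (pc_ob A X) ∘ pc_tau (PCpow_ob 2 A) f.
Proof.
have [u hu] := tadd_pair_map (tif_TM F f) (pc_ob A Y : fibre F Y).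
have [u0 u1] := hu.
have n := naturality (tadd (tif_str F X)) (pc_tau A f).
rewrite /= -compmA (tm_add (tif_mor F f) hu) compmA -n -compmA; congr (_ ∘ _).
apply: (ifp_uniq2 (fpP (tpow (tif_str F X) 2 (pc_ob A X)))).
- by rewrite compmA !fp_tuple_proj -compmA u0 compmA.
- by rewrite compmA !fp_tuple_proj -compmA u1 compmA.
Qed.

Definition PCadd_hom (A : PC) : PChom (PCpow_ob 2 A) (PCT A) :=
  @MkPChom C F (PCpow_ob 2 A) (PCT A)
    (fun X => tadd (tif_str F X) (pc_ob A X)) (@PCadd_subproof A).

Lemma PCpowF_hom (n : nat) (A B : PC) (f : A ~> B) (X : C) :
  pc_hom (fmap (powF (PCpow n)) f) X
  = fmap (powF (tpow (tif_str F X) n)) (pc_hom f X).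
Proof.
apply: (ifp_uniq (fpP (tpow (tif_str F X) n (pc_ob B X)))) => [|i].
- have e : fp_base (PCpow n B) ∘ fmap (powF (PCpow n)) f = f ∘ fp_base (PCpow n A)
    := fp_tuple_base _ _.
  apply: etrans (f_equal (fun h : PChom (PCpow_ob n A) B => h X) e) _.
  exact: esym (fp_tuple_base _ _).
- have e : fp_proj (PCpow n B) i ∘ fmap (powF (PCpow n)) f
    = fmap PCT f ∘ fp_proj (PCpow n A) i := fp_tuple_proj _ _ i.
  apply: etrans (f_equal (fun h : PChom (PCpow_ob n A) (PCT B) => h X) e) _.
  exact: esym (fp_tuple_proj _ _ i).
Qed.

Definition PCadd : NatTrans (powF (PCpow 2)) PCT.
Proof.
refine (@MkNatTrans PC PC (powF (PCpow 2)) PCT PCadd_hom _).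
abstract (move=> A B f; apply: PChom_eq => X;
  have n := naturality (tadd (tif_str F X)) (pc_hom f X);
  by rewrite -PCpowF_hom in n).
Defined.

Definition PCl : NatTrans PCT (compF PCT PCT).
Proof.
unshelve refine (@MkNatTrans PC PC PCT (compF PCT PCT)
  (fun A => @MkPChom C F (PCT A) (PCT (PCT A))
     (fun X => tl (tif_str F X) (pc_ob A X)) _) _).
- abstract (move=> X Y f /=;
    have n : tl (tif_str F X) (A X) ∘ fmap T_ X (pc_tau A f)
      = fmap T_ X (fmap T_ X (pc_tau A f)) ∘ tl (tif_str F X) (f^* (A Y))
      := naturality (tl (tif_str F X)) (pc_tau A f);
    by rewrite fmapM compmA n -!(compmA (fmap T_ X (fmap T_ X (pc_tau A f))))
       (tm_l (tif_mor F f)) ?compmA).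
- abstract (by move=> A B f; apply: PChom_eq => X; exact: (naturality (tl (tif_str F X)))).
Defined.

Definition PCc : NatTrans (compF PCT PCT) (compF PCT PCT).
Proof.
unshelve refine (@MkNatTrans PC PC (compF PCT PCT) (compF PCT PCT)
  (fun A => @MkPChom C F (PCT (PCT A)) (PCT (PCT A))
     (fun X => tc (tif_str F X) (pc_ob A X)) _) _).
- abstract (move=> X Y f /=;
    have n : tc (tif_str F X) (A X) ∘ fmap T_ X (fmap T_ X (pc_tau A f))
      = fmap T_ X (fmap T_ X (pc_tau A f)) ∘ tc (tif_str F X) (f^* (A Y))
      := naturality (tc (tif_str F X)) (pc_tau A f);
    by rewrite !fmapM !compmA n -!(compmA (fmap T_ X (fmap T_ X (pc_tau A f))))
       (tm_c (tif_mor F f)) ?compmA).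
- abstract (by move=> A B f; apply: PChom_eq => X; exact: (naturality (tc (tif_str F X)))).
Defined.

Lemma PC_pair (Z P E : PC) (pi : 'I_2 -> (P ~> E)) (u : Z ~> P) (x y : Z ~> E)
  (X : C) :
  is_pair pi u x y ->
  is_pair (fun i => pc_hom (pi i) X) (pc_hom u X) (pc_hom x X) (pc_hom y X).
Proof. by case=> <- <-. Qed.

Definition PCstr : TangentStructure PC.
Proof.
refine (@MkTangentStructure PC PCT PCp PCpow _ PC0 PCadd PCl PCc
          _ _ _ _ _ _ _ _ _ _ _ _ _ _ _ _ _).
- abstract (move=> n m A; apply: PC_iter_ifp => X; exact: (tpow_pres (tif_str F X) n m)).
- abstract (by move=> A; apply: PChom_eq => X; exact: tp_0).
- abstract (by move=> A; apply: PChom_eq => X; exact: tp_add).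
- abstract (move=> A u v l r hu hv hl hr; apply: PChom_eq => X;
    exact: (taddA (PC_pair X hu) (PC_pair X hv) (PC_pair X hl) (PC_pair X hr))).
- abstract (by move=> A u hu; apply: PChom_eq => X; exact: (tadd0 (PC_pair X hu))).
- abstract (by move=> A u hu; apply: PChom_eq => X; exact: (taddC (PC_pair X hu))).
- abstract (by move=> A; apply: PChom_eq => X; exact: tl_p).
- abstract (by move=> A u hu; apply: PChom_eq => X; exact: (tl_add (PC_pair X hu))).
- abstract (by move=> A; apply: PChom_eq => X; exact: tl_0).
- abstract (by move=> A; apply: PChom_eq => X; exact: tc_p).
- abstract (by move=> A u hu; apply: PChom_eq => X; exact: (tc_add (PC_pair X hu))).
- abstract (by move=> A; apply: PChom_eq => X; exact: tc_0).
- abstract (by move=> A; apply: PChom_eq => X; exact: tcc).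
- abstract (by move=> A; apply: PChom_eq => X; exact: tc_l).
- abstract (by move=> A; apply: PChom_eq => X; exact: tl_l).
- abstract (by move=> A; apply: PChom_eq => X; exact: tc_braid).
- abstract (by move=> A; apply: PChom_eq => X; exact: tc_tl).
- abstract (move=> A u hu; apply: PC_eqz => X; exact: (tl_univ (PC_pair X hu))).
Defined.

Definition PCtan : TangentCategory := MkTangentCategory PCstr.

Definition PCpr_fun (X : C) : Functor PC (fibre F X) :=
  @MkFunctor PC (fibre F X) (fun A => pc_ob A X) (fun A B r => pc_hom r X)
    (fun A => erefl) (fun A B D g f => erefl).

Definition PCpr_nat (X : C) :
  NatTrans (compF (PCpr_fun X) PCT) (compF (T_ X) (PCpr_fun X)).
Proof.
refine (@MkNatTrans PC (fibre F X) (compF (PCpr_fun X) PCT)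
          (compF (T_ X) (PCpr_fun X)) (fun A => idm (T_ X (pc_ob A X))) _).
abstract (by move=> A B f; rewrite comp1m compm1).
Defined.

Lemma PCpr_P (X : C) :
  is_tangent_morphism (TD := PCstr) (TE := tif_str F X) (PCpr_nat X).
Proof.
split=> [A|A|A u [u0 u1]|A|A] /=; rewrite ?comp1m ?fmap1 ?comp1m ?compm1 //.
move: u0 u1; rewrite /= !comp1m => u0 u1.
rewrite (_ : u = idm _) ?compm1 //.
by apply: (ifp_uniq2 (fpP (tpow (tif_str F X) 2 (pc_ob A X))));
  rewrite ?u0 ?u1 compm1.
Qed.

Definition PCpr (X : C) : TangentMorphism PCtan (tif_ob F X) :=
  @MkTangentMorphism PCtan (tif_ob F X) (PCpr_fun X) (PCpr_nat X) (PCpr_P X).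

Lemma PCpr_strong (X : C) : @strong PCtan (tif_ob F X) (PCpr X).
Proof.
split=> [A|n A|A u hu] /=.
- exact: is_iso_id.
- exact: (fpP (tpow (tif_str F X) n (pc_ob A X))).
- exact: (tl_univ (PC_pair X hu)).
Qed.

Definition PCcone_nat (X Y : C) (f : X ~> Y) :
  NatTrans (compF f^* (PCpr_fun Y)) (PCpr_fun X) :=
  @MkNatTrans PC (fibre F X) (compF f^* (PCpr_fun Y)) (PCpr_fun X)
    (fun A => pc_tau (A : PCob F) f) (fun A B r => pc_homP (r : PChom A B) f).

Lemma PCcone_P (X Y : C) (f : X ~> Y) (A : PC) :
  fmap (T_ X) (PCcone_nat f A) ∘ tm_nat (compTM (tif_TM F f) (PCpr Y)) A
  = tm_nat (PCpr X) A ∘ PCcone_nat f (PCT A).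
Proof. by rewrite /= fmap1 compm1 comp1m. Qed.

Definition PCcone_TT (X Y : C) (f : X ~> Y) :
  TangentTransformation (compTM (tif_TM F f) (PCpr Y)) (PCpr X) :=
  @MkTangentTransformation _ _ (compTM (tif_TM F f) (PCpr Y)) (PCpr X)
    (PCcone_nat f) (@PCcone_P X Y f).

Lemma pc_tau_id (A : PCob F) (X : C) (e : (idm X)^* (A X) = A X) :
  pc_tau A (idm X) = eqhom e.
Proof.
have tau_eq Y (f g : X ~> Y) (p : f = g) (q : f^* (A Y) = g^* (A Y)) :
  pc_tau A g ∘ eqhom q = pc_tau A f by subst g; rewrite eqhom_id compm1.
have h := pc_cocycle A (idm X) (idm X).
have [q eq] : exists q : (idm X)^* ((idm X)^* (A X)) = (idm X ∘ idm X)^* (A X),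
    compositor F (idm X) (idm X) (A X) = eqhom q.
  by exists (f_equal (fun H : Functor (fibre F X) (fibre F X) => H (A X))
       (etrans (f_equal (fun u => u ⋅ pf1 F (idm X)) (pf_id F X))
         (etrans (comp1_1l (pf1 F (idm X)))
           (f_equal (@pf1 _ _ F X X) (esym (compm1 (idm X)))))));
     rewrite /compositor pf2_idl coe_Cat.
have q' : (idm X ∘ idm X)^* (A X) = (idm X)^* (A X) by rewrite comp1m.
rewrite eq -(tau_eq _ _ _ (comp1m (idm X)) q') -compmA eqhom_comp in h.
have h1 := iso_mono (pc_iso A (idm X)) h.
have nat (f : (idm X)^* (A X) ~> A X) (r : (idm X)^* ((idm X)^* (A X)) = (idm X)^* (A X)) :
  eqhom e ∘ fmap (idm X)^* f = f ∘ eqhom r.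
  have pid : (pf1 F (idm X) : Functor (fibre F X) (fibre F X)) = idF (fibre F X) := pf_id F X.
  move: f e r {h h1 q eq q' tau_eq}; rewrite /reindex pid /= => f e r.
  by rewrite !eqhom_id comp1m compm1.
apply: (iso_epi (f := eqhom (etrans q q'))).
  exists (eqhom (esym (etrans q q'))).
  by split; rewrite eqhom_comp eqhom_id.
by rewrite -(nat _ (etrans q q')) -h1.
Qed.

Definition PCcone : PseudoCone (tif_Tan F) (PCtan : Tan).
Proof.
refine (@MkPseudoCone C Tan (tif_Tan F) PCtan PCpr PCcone_TT _ _ _).
- abstract (by move=> X Y f; apply: Tan_inv => A; exact: pc_iso).
- abstract (by move=> X; apply: TangentTransformation_eq => A;
    rewrite coe_Tan; exact: pc_tau_id).
- abstract (move=> X Y Z f g; apply: TangentTransformation_eq => A /=;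
    rewrite coe_Tan eqhom_id compm1; exact: (pc_cocycle (A : PCob F) f g)).
Defined.

Definition PCcone_strong : PseudoCone (tif_Tan_strong F) (PCtan : Tan_strong) :=
  lift_cone strong_id strong_comp (D := tif_Tan F)
    (fun X Y f => tif_strong F f) (k := PCcone) PCpr_strong.

End PC.

(* Main.v *)
(* A pseudocone [k] on [V] assigns to each [A] in [V] the family of the [k_X A]
   with transition maps the components of the [k_f]; this is an object of PC(F),
   and everything else about the mediating morphism holds componentwise.
   In the other direction a tangent morphism, or transformation, into PC(F) is
   determined by its composites with the projections together with the
   transition maps. The strict equalities of 1-cells in the universal property
   are treated as the invertible 2-cells [coe e], so uniqueness of 1-cells and the
   universal property for 2-cells both rest on the same lifting of 2-cells,
   [PCtan_2cell]. For strong morphisms it suffices that the projections jointly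
   reflect isomorphisms, fibre powers and equalizers. *)

From mathcomp Require Import all_boot.
From Stdlib Require Import FunctionalExtensionality ProofIrrelevance IndefiniteDescription.
Require Import Defs.

Set Implicit Arguments.
Unset Strict Implicit.
Unset Printing Implicit Defensive.
Local Open Scope cat_scope.

(** * Calculus of the identity 2-cells [coe] *)

Lemma coe_esymK (K : TwoCategory) (A B : K) (f g : hom1 A B) (e : f = g) :
  coe (esym e) • coe e = id2 f.
Proof. by case: g / e; exact: vcomp_1l. Qed.

Lemma coeK (K : TwoCategory) (A B : K) (f g : hom1 A B) (e : f = g) :
  coe e • coe (esym e) = id2 g.
Proof. by case: g / e; exact: vcomp_1l. Qed.

Lemma coe_etrans (K : TwoCategory) (A B : K) (f g h : hom1 A B)
    (e : f = g) (e' : g = h) : coe e' • coe e = coe (etrans e e').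
Proof. by case: h / e'; exact: vcomp_1l. Qed.

(** Both composites have convertible values on objects, so proof irrelevance reduces the component
    to an identity, whatever the proof [e]. *)
Lemma coe_Tan_comp1A (A B C D : TangentCategory) (h : TangentMorphism C D)
    (g : TangentMorphism B C) (f : TangentMorphism A B)
    (e : compTM h (compTM g f) = compTM (compTM h g) f :> @hom1 TanData A D) (X : A) :
  (coe e : TangentTransformation (compTM h (compTM g f)) (compTM (compTM h g) f)) X
  = idm (h (g (f X))).
Proof. by rewrite coe_Tan; exact: eqhom_id. Qed.

(** * Pseudolimits in a locally full sub-2-category *)

Section LocallyFullSub.
Variables (K : TwoCategory) (P : forall A B : K, hom1 A B -> Prop).
Hypothesis P1 : forall A, P (id1 A).
Hypothesis PM : forall (A B C : K) (g : hom1 B C) (f : hom1 A B),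
  P g -> P f -> P (g ⋅ f).
Variables (C : Category) (D : PseudoFunctor C K).
Hypothesis PD : forall (X Y : C) (f : X ~> Y), P (pf1 D f).

Let S := Sub2 P1 PM.

Definition forget_cone (V : K) (k : PseudoCone (lift_pf P1 PM PD) (V : S)) :
  PseudoCone D V.
Proof.
refine (@MkPseudoCone C K D V (fun X => sub1 (pc1 k X))
  (fun X Y f => pc2 k f) _ _ _).
- abstract (by move=> X Y f; exact: (pc2_inv k f)).
- abstract (move=> X; have := pc2_id k X; rewrite coe_Sub2 => ->; exact: coe_irr).
- abstract (move=> X Y Z f g; have := pc2_comp k f g; rewrite coe_Sub2 /= => <-;
    f_equal; exact: coe_irr).
Defined.

Variables (L : K) (l : PseudoCone D L).
Hypothesis Pl : forall X, P (pc1 l X).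
Let l' := lift_cone P1 PM PD Pl.

(** The 2-cells of [Sub2] are those of [K], so the two sides differ only in the proofs under [coe],
    which [coe_irr] identifies. *)
Lemma factors_forget (V : K) (k : PseudoCone (lift_pf P1 PM PD) (V : S))
    (r : @hom1 S V L) (e : forall X : C, pc1 l' X ⋅ r = pc1 k X)
    (e0 : forall X : C, pc1 l X ⋅ sub1 r = sub1 (pc1 k X)) :
  factors (l := l') (k := k) (r := r) e <->
  factors (l := l) (k := forget_cone k) (r := sub1 r) e0.
Proof.
split=> h X Y f; have := h X Y f; rewrite /= !coe_Sub2 /=.
- rewrite (coe_irr _ (e0 X)) (coe_irr _ (e0 Y)).
  by rewrite (coe_irr _ (comp1A (pf1 D f) (pc1 l Y) (sub1 r))).
- rewrite (coe_irr (e0 X) (f_equal (@sub1 _ _ _ _) (e X))).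
  rewrite (coe_irr (e0 Y) (f_equal (@sub1 _ _ _ _) (e Y))) => <-.
  by f_equal; exact: coe_irr.
Qed.

(** The first hypothesis puts the mediating 1-cell into the sub-2-category, because its composites
    with the projections are the legs of a cone there. Local fullness carries over the 2-cells. *)
Lemma lift_pseudolimit :
  (forall (V : K) (r : hom1 V L), (forall X, P (pc1 l X ⋅ r)) -> P r) ->
  is_pseudolimit l -> @is_pseudolimit C S (lift_pf P1 PM PD) (L : S) l'.
Proof.
move=> reflP [U1 U2]; split=> [V k|V k k' r r' e e' he he' th mth].
- have [r [[e he] ur]] := U1 V (forget_cone k).
  have Pr : P r by apply: reflP => X; rewrite e; exact: sub1P.
  pose e1 X : pc1 l' X ⋅ (MkSubhom1 Pr : @hom1 S V L) = pc1 k X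
    := subhom1_eq (f := sub2_comp PM (pc1 l' X) (MkSubhom1 Pr)) (e X).
  exists (MkSubhom1 Pr); split; first by exists e1; apply/(factors_forget e1 e).
  move=> r' [e' he']; apply: subhom1_eq; apply: ur.
  pose e0 X : pc1 l X ⋅ sub1 r' = sub1 (pc1 k X) := f_equal (@sub1 _ _ _ _) (e' X).
  by exists e0; apply/(factors_forget e' e0).
- pose e0 X : pc1 l X ⋅ sub1 r = sub1 (pc1 k X) := f_equal (@sub1 _ _ _ _) (e X).
  pose e0' X : pc1 l X ⋅ sub1 r' = sub1 (pc1 k' X) := f_equal (@sub1 _ _ _ _) (e' X).
  have f0 : factors (l := l) (k := forget_cone k) (r := sub1 r) e0.
    by apply/(factors_forget e e0).
  have f0' : factors (l := l) (k := forget_cone k') (r := sub1 r') e0'.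
    by apply/(factors_forget e' e0').
  have [rho [hrho urho]] := U2 V _ _ _ _ _ _ f0 f0' th mth.
  exists rho; split=> [X|s hs].
  + by rewrite !coe_Sub2; exact: hrho.
  + by apply: urho => X; have := hs X; rewrite !coe_Sub2.
Qed.

End LocallyFullSub.

(** * Equality and isomorphisms in PC(F) *)

Section PseudoLimit.
Variables (C : Category) (F : TangentIndexingFunctor C).
Local Notation PC := (PCcat F).
Local Notation "'T_' X" := (tT (tif_str F X)) (at level 8, X at level 8) : cat_scope.
Local Notation "f ^*" := (reindex F f) : cat_scope.

Lemma PCob_eq (A B : PCob F) (e : forall X, A X = B X) :
  (forall (X Y : C) (f : X ~> Y),
     eqhom (e X) ∘ pc_tau A f = pc_tau B f ∘ fmap f^* (eqhom (e Y))) ->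
  A = B.
Proof.
case: A B e => [a ta ia ca] [b tb ib cb] /= e.
have ab : a = b by apply: functional_extensionality_dep.
subst b => h.
have tab : ta = tb.
  apply: functional_extensionality_dep => X.
  apply: functional_extensionality_dep => Y.
  apply: functional_extensionality_dep => f.
  by have := h X Y f; rewrite !eqhom_id fmap1 comp1m compm1.
by subst tb; f_equal; apply: proof_irrelevance.
Qed.

Lemma pc_hom_eqhom (A B : PC) (e : A = B) (X : C) :
  pc_hom (eqhom e) X = eqhom (f_equal (fun Z : PC => pc_ob Z X) e).
Proof. by case: B / e. Qed.

(** The componentwise inverses commute with the transition maps: cancel the isomorphism [pc_hom f X]
    on the left. *)
Lemma PC_is_iso (A B : PC) (f : A ~> B) :
  (forall X, is_iso (pc_hom f X)) -> is_iso f.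
Proof.
move=> isof.
pose g X := proj1_sig (constructive_indefinite_description _ (isof X)).
have gP X : is_inverse (pc_hom f X) (g X).
  by rewrite /g; case: constructive_indefinite_description.
have hP X Y (u : X ~> Y) : pc_tau A u ∘ fmap u^* (g Y) = g X ∘ pc_tau B u.
  apply: (iso_mono (isof X)).
  rewrite !compmA -pc_homP (proj2 (gP X)) comp1m -compmA -fmapM.
  by rewrite (proj2 (gP Y)) fmap1 compm1.
exists (MkPChom hP); split; apply: PChom_eq => X.
- exact: (proj1 (gP X)).
- exact: (proj2 (gP X)).
Qed.

(** * The mediating morphism of a pseudocone *)

Section Cone.
Variables (V : TangentCategory) (k : PseudoCone (tif_Tan F) (V : Tan)).

Let k1 (X : C) : TangentMorphism V (tif_ob F X) := pc1 k X.
Let k2 (X Y : C) (f : X ~> Y) :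
  TangentTransformation (compTM (tif_TM F f) (k1 Y)) (k1 X) := pc2 k f.

(** At [A] the associator is an identity and [pc2 (PCcone F) f ▷ r] is [pc_tau (r A) f]; what
    remains is that the [coe (e X)] respect the transition maps. *)
Lemma factorsE (r : TangentMorphism V (PCtan F))
    (e : forall X : C, pc1 (PCcone F) X ⋅ (r : @hom1 Tan V (PCtan F)) = pc1 k X) :
  factors (l := PCcone F) (k := k) (r := r) e <->
  forall (X Y : C) (f : X ~> Y) (A : V),
    (coe (e X) : TangentTransformation (compTM (PCpr F X) r) (k1 X)) A
      ∘ pc_tau (r A : PCob F) f
    = k2 f A ∘ fmap f^* ((coe (e Y) : TangentTransformation (compTM (PCpr F Y) r) (k1 Y)) A).
Proof.
split=> h X Y f.
- move=> A; have := f_equal (fun n : TangentTransformation _ _ => n A) (h X Y f).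
  by rewrite /= coe_Tan_comp1A compm1.
- apply: TangentTransformation_eq => A.
  by rewrite /= coe_Tan_comp1A compm1; exact: h.
Qed.

Definition med_ob (A : V) : PCob F.
Proof.
refine (@MkPCob C F (fun X => k1 X A) (fun X Y f => k2 f A) _ _).
- abstract (move=> X Y f; have [b [b1 b2]] := pc2_inv k f;
    exists ((b : TangentTransformation (k1 X) (compTM (tif_TM F f) (k1 Y))) A); split;
    [ exact: (f_equal (fun n : TangentTransformation _ _ => n A) b1)
    | exact: (f_equal (fun n : TangentTransformation _ _ => n A) b2) ]).
- abstract (move=> X Y Z f g;
    have := f_equal (fun n : TangentTransformation _ _ => n A) (pc2_comp k f g);
    by rewrite /= coe_Tan_comp1A compm1).
Defined.

Definition med_fun : Functor V PC.
Proof.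
unshelve refine (@MkFunctor V PC med_ob
  (fun A B u => @MkPChom C F (med_ob A) (med_ob B) (fun X => fmap (k1 X) u) _) _ _).
- abstract (move=> X Y f; exact: (naturality (k2 f) u)).
- abstract (by move=> A; apply: PChom_eq => X; exact: fmap1).
- abstract (by move=> A B D g f; apply: PChom_eq => X; exact: fmapM).
Defined.

(** Compatibility with the transition maps is the tangent transformation axiom [ttP] of [k2 f]. *)
Definition med_nat :
  NatTrans (compF med_fun (tT (tstr V))) (compF (PCT F) med_fun).
Proof.
unshelve refine (@MkNatTrans V PC (compF med_fun (tT (tstr V)))
  (compF (PCT F) med_fun)
  (fun A => @MkPChom C F (med_ob (tT (tstr V) A)) (PCT_ob (med_ob A))
     (fun X => tm_nat (k1 X) A) _) _).
- abstract (move=> X Y f; rewrite -(ttP (k2 f) A) /= compmA //).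
- abstract (by move=> A B u; apply: PChom_eq => X; exact: (naturality (tm_nat (k1 X)))).
Defined.

Lemma med_P : is_tangent_morphism (TD := tstr V) (TE := PCstr F) med_nat.
Proof.
split=> [A|A|A u hu|A|A]; apply: PChom_eq => X.
- exact: (tm_p (tmP (k1 X))).
- exact: (tm_0 (tmP (k1 X))).
- exact: (tm_add (tmP (k1 X)) (PC_pair X hu)).
- exact: (tm_l (tmP (k1 X))).
- exact: (tm_c (tmP (k1 X))).
Qed.

Definition med : TangentMorphism V (PCtan F) :=
  @MkTangentMorphism V (PCtan F) med_fun med_nat med_P.

Lemma PCpr_med (X : C) : compTM (PCpr F X) med = k1 X.
Proof.
have e : compF (PCpr_fun F X) med_fun = k1 X by functor_refl.
apply: (@TangentMorphism_eq _ _ (compTM (PCpr F X) med) (k1 X) e) => A /=.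
by rewrite !eqhom_id fmap1 comp1m comp1m compm1.
Qed.

Lemma med_factors : factors (l := PCcone F) (k := k) (r := med) PCpr_med.
Proof.
apply/factorsE => X Y f A.
by rewrite !coe_Tan !eqhom_id fmap1 comp1m compm1.
Qed.

End Cone.

(** * 2-cells into PC(F) and equality of 1-cells *)

Section TwoCells.
Variables (V : TangentCategory) (r r' : TangentMorphism V (PCtan F)).
Variable th : forall X : C,
  TangentTransformation (compTM (PCpr F X) r) (compTM (PCpr F X) r').
Hypothesis thP : forall (X Y : C) (f : X ~> Y) (A : V),
  th X A ∘ pc_tau (r A : PCob F) f = pc_tau (r' A : PCob F) f ∘ fmap f^* (th Y A).

(** [thP] is what makes the family [th X A] a morphism of PC(F); naturality and the tangent axiom
    are then checked for each [X] separately. *)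
Lemma PCtan_2cell : exists rho : TangentTransformation r r',
  forall X A, pc_hom (rho A) X = th X A.
Proof.
pose h A : @Hom PC (r A) (r' A) :=
  @MkPChom C F (r A) (r' A) (fun X => th X A) (fun (X Y : C) (f : X ~> Y) => esym (thP f A)).
have nh A B (u : A ~> B) : h B ∘ fmap r u = fmap r' u ∘ h A.
  by apply: PChom_eq => X; exact: (naturality (th X) u).
have th_h A : fmap (PCT F) (h A) ∘ tm_nat r A
    = tm_nat r' A ∘ h (tT (tstr V) A).
  by apply: PChom_eq => X; have := ttP (th X) A; rewrite /= !comp1m.
by exists (@MkTangentTransformation V (PCtan F) r r' (MkNatTrans nh) th_h).
Qed.

End TwoCells.

(** The [coe (e X)] lift to a 2-cell [rho] whose components are all of the form [eqhom]. Its
    naturality then gives equality of the functors, and its tangent axiom equality of the structure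
    maps. *)
Lemma PCtan_1cell_eq (V : TangentCategory) (r r' : TangentMorphism V (PCtan F))
    (e : forall X, compTM (PCpr F X) r = compTM (PCpr F X) r') :
  (forall (X Y : C) (f : X ~> Y) (A : V),
     (coe (e X : (_ : @hom1 Tan _ _) = _) : TangentTransformation _ _) A
       ∘ pc_tau (r A : PCob F) f
     = pc_tau (r' A : PCob F) f
       ∘ fmap f^* ((coe (e Y : (_ : @hom1 Tan _ _) = _) : TangentTransformation _ _) A)) ->
  r = r'.
Proof.
move=> he.
have [rho rhoP] := PCtan_2cell he.
have eob A : r A = r' A.
  apply: (PCob_eq (e := fun X => f_equal (fun M : TangentMorphism V _ => M A) (e X))).
  by move=> X Y f; have := he X Y f A; rewrite !coe_Tan.
have rhoE A (q : r A = r' A) : rho A = eqhom q.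
  apply: PChom_eq => X; rewrite rhoP coe_Tan pc_hom_eqhom; exact: eqhom_irr.
have er : tm_fun r = tm_fun r'.
  apply: (functor_eq (e := eob)) => A B f.
  by rewrite -!rhoE; exact: (naturality rho f).
by apply: (TangentMorphism_eq (e := er)) => A; rewrite -!rhoE; exact: (ttP rho A).
Qed.

(** Transports [th] along the strict equalities to 2-cells between composites with the projections,
    the input of [PCtan_2cell]. *)
Definition conj_coe (V : Tan) (k k' : PseudoCone (tif_Tan F) V)
    (r r' : hom1 V (PCtan F : Tan))
    (e : forall X : C, pc1 (PCcone F) X ⋅ r = pc1 k X)
    (e' : forall X : C, pc1 (PCcone F) X ⋅ r' = pc1 k' X)
    (th : forall X : C, hom2 (pc1 k X) (pc1 k' X)) (X : C) :
  TangentTransformation (compTM (PCpr F X) r) (compTM (PCpr F X) r') :=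
  coe (esym (e' X)) • th X • coe (e X).

Lemma conj_coeP (V : Tan) (k k' : PseudoCone (tif_Tan F) V)
    (r r' : hom1 V (PCtan F : Tan))
    (e : forall X : C, pc1 (PCcone F) X ⋅ r = pc1 k X)
    (e' : forall X : C, pc1 (PCcone F) X ⋅ r' = pc1 k' X)
    (th : forall X : C, hom2 (pc1 k X) (pc1 k' X)) :
  factors (l := PCcone F) (k := k) (r := r) e ->
  factors (l := PCcone F) (k := k') (r := r') e' ->
  is_modification th ->
  forall (X Y : C) (f : X ~> Y) (A : tcat V),
    conj_coe e e' th X A ∘ pc_tau ((r : TangentMorphism _ _) A : PCob F) f
    = pc_tau ((r' : TangentMorphism _ _) A : PCob F) f ∘ fmap f^* (conj_coe e e' th Y A).
Proof.
move=> /factorsE he /factorsE he' mth X Y f A.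
have inv Z : is_inverse ((coe (e' Z) : TangentTransformation _ _) A)
               ((coe (esym (e' Z)) : TangentTransformation _ _) A).
  split.
  - exact: (f_equal (fun n : TangentTransformation _ _ => n A) (coe_esymK (e' Z))).
  - exact: (f_equal (fun n : TangentTransformation _ _ => n A) (coeK (e' Z))).
have iso Z : is_iso ((coe (e' Z) : TangentTransformation _ _) A).
  by eexists; exact: inv.
have mA := f_equal (fun n : TangentTransformation _ _ => n A) (mth X Y f).
(* Cancelling [coe (e' X)] leaves a pasting of three squares: [he'], [he] and the modification
   axiom. *)
apply: (iso_mono (iso X)); rewrite /= in mA *.
rewrite !compmA (proj2 (inv X)) comp1m he' -(compmA _ _ (pc_tau _ f)) he compmA mA.
rewrite -!compmA -!fmapM; congr (_ ∘ fmap _ _).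
by rewrite !compmA (proj2 (inv Y)) comp1m.
Qed.

(** * The universal property and strong morphisms *)

Lemma PCtan_pseudolimit : @is_pseudolimit C Tan (tif_Tan F) (PCtan F) (PCcone F).
Proof.
split=> [V k|V k k' r r' e e' he he' th mth].
- exists (med k); split; first by exists (PCpr_med k); exact: med_factors.
  move=> r [e he].
  apply: (PCtan_1cell_eq (e := fun X => etrans (PCpr_med k X) (esym (e X)))).
  (* Uniqueness: the identity modification of [k], conjugated, is the [coe] comparing [med k] with
     [r], so [conj_coeP] shows that it respects the transition maps. *)
  have mid : is_modification (fun X => id2 (pc1 k X)).
    by move=> X Y f; rewrite lwhisk1 vcomp_1l vcomp_1r.
  have conjE X : conj_coe (PCpr_med k) e (fun X => id2 (pc1 k X)) X
      = coe (etrans (PCpr_med k X) (esym (e X)) : (_ : @hom1 Tan _ _) = _).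
    by rewrite /conj_coe vcomp_1r coe_etrans.
  move=> X Y f A; rewrite -!conjE.
  exact: (conj_coeP (@med_factors _ k) he mid).
- have [rho rhoP] := PCtan_2cell (conj_coeP he he' mth).
  have conjE X : conj_coe e e' th X = pc1 (PCcone F) X ◁ (rho : hom2 r r').
    by apply: TangentTransformation_eq => A /=; rewrite rhoP.
  exists rho; split=> [X|s hs].
    by rewrite -conjE /conj_coe !vcompA coeK vcomp_1l.
  apply: TangentTransformation_eq => A; apply: PChom_eq => X; rewrite rhoP.
  (* Solving [hs] for the whiskered 2-cell determines every component of [s]. *)
  have -> : conj_coe e e' th X = pc1 (PCcone F) X ◁ s.
    by rewrite /conj_coe -vcompA -hs vcompA coe_esymK vcomp_1l.
  by [].
Qed.

(** Up to an identity factor, the structure map of the composite with [PCpr F X] is the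
    [X]-component of that of [r]. *)
Lemma strong_PC (V : TangentCategory) (r : TangentMorphism V (PCtan F)) :
  (forall X, @strong V (tif_ob F X) (compTM (PCpr F X) r)) ->
  @strong V (PCtan F) r.
Proof.
move=> sr; split=> [A|n A|A u hu].
- by apply: PC_is_iso => X; have := st_iso (sr X) A; rewrite /= comp1m.
- by apply: PC_ifp => X; exact: (st_pow (sr X) n A).
- by apply: PC_eqz => X; exact: (st_univ (sr X) hu).
Qed.

End PseudoLimit.

Theorem theorem4p9 (C : Category) (F : TangentIndexingFunctor C) :
  @is_pseudolimit C Tan (tif_Tan F) (PCtan F) (PCcone F) /\
  @is_pseudolimit C Tan_strong (tif_Tan_strong F) (PCtan F) (PCcone_strong F).
Proof.
split; first exact: PCtan_pseudolimit.
apply: lift_pseudolimit; first exact: strong_PC.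
exact: PCtan_pseudolimit.
Qed.
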